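(* Work in the setting described in the context (bounded-domain data assumption, $r\ge0$, boundary assumptions (Q1)–(Q3), mesh hypotheses, fixed cubature, stopped scheme). Let $\kappa=1$, let $C_G=\sup_{(t,x,a)\in[0,T]\times\overline O\times A}|F^a[G](t,x)|$, fix $$K_{\rm bar}\ge\max\Bigl\{C_{\rm comp},\frac{C_G+2\kappa}{\beta}\Bigr\},\qquad \Phi_+=G+K_{\rm bar}\zeta,\qquad \Phi_-=G-K_{\rm bar}\zeta .$$ Assume $0<\Delta t\le1$. There is a constant $C_{\rm bar}>0$, independent of $h$, $\Delta t$, the row $(n,i)$ and the control, such that for every interior row ($x_i\in G_h\cap O$, $0\le n<N_{\Delta t}$), including rows on which one or more branches stop before $t_{n+1}$, and every $a\in A$, $$\mathcal R^a_{h,n,i}\bigl[\Phi_+(t_n,x_i),\Phi_+(t_{n+1},\cdot)\bigr]\le-\kappa+C_{\rm bar}\Bigl(\Delta t^{\gamma/2}+\frac{h^2}{\Delta t}\Bigr),$$ $$\mathcal R^a_{h,n,i}\bigl[\Phi_-(t_n,x_i),\Phi_-(t_{n+1},\cdot)\bigr]\ge\kappa-C_{\rm bar}\Bigl(\Delta t^{\gamma/2}+\frac{h^2}{\Delta t}\Bigr).$$ If moreover $C_{\rm bar}\bigl(\Delta t^{\gamma/2}+h^2/\Delta t\bigr)\le\kappa/2$, then $$G-K_{\rm bar}\zeta\le u_h\le G+K_{\rm bar}\zeta,\qquad G-K_{\rm bar}\zeta\le u\le G+K_{\rm bar}\zeta,$$ the first pair of inequalities at all grid points $(t_n,x_i)$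 and the second on $[0,T]\times\overline O$, where $u$ is the unique bounded continuous strong Dirichlet viscosity solution of the HJB problem and $u_h$ is the solution of the stopped scheme.
   Context: **Data.** $N,p\ge1$ are integers, $O\subset\mathbb R^N$ is a bounded domain, $T>0$, $Q_T=[0,T)\times O$, $Q_T^{\mathrm{cl}}=[0,T]\times\overline O$. $|\cdot|$ is the absolute value, Euclidean norm or Frobenius norm. $(A,d_A)$ is a nonempty compact metric space; $\sigma(t,x,a)\in\mathbb R^{N\times p}$, $\mu(t,x,a)\in\mathbb R^N$, $r(t,x,a),f(t,x,a)\in\mathbb R$ are defined on $[0,T]\times\overline O\times A$; $\Psi:\overline O\to\mathbb R$; $u_\partial:[0,T]\times\partial O\to\mathbb R$. Write $g^a(t,x)=g(t,x,a)$, $A^a=\sigma^a(\sigma^a)^\top$, and $$F^a[\varphi]=\partial_t\varphi+\tfrac12\operatorname{Tr}(A^aD^2\varphi)+\mu^a\cdot D\varphi-r^a\varphi+f^a .$$ *Bounded-domain data assumption:* there is $K_0>0$ with $\|\Psi\|_\infty+\|u_\partial\|_\infty+\sup_a(\|\sigma^a\|_\infty+\|\mu^a\|_\infty+\|r^a\|_\infty+\|f^a\|_\infty)\le K_0$; $|\Psi(x)-\Psi(y)|\le K_0|x-y|$; $|u_\partial(t,x)-u_\partial(s,y)|\le K_0(|x-y|+|t-s|^{1/2})$ on $[0,T]\times\partial O$; for each $g\in\{\sigma,\mu,r,f\}$, $|g(t,x,a)-g(s,y,a)|\le K_0(|x-y|+|t-s|^{1/2})$ for all $(t,x),(s,y)\in[0,T]\times\overline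 O$, $a\in A$; and for each fixed $(t,x)$ the coefficients are continuous in $a$. Also $r\ge0$. **Hölder spaces.** With $\varrho((t,x),(s,y))=|x-y|+|t-s|^{1/2}$ and $0<\gamma\le1$, $[w]_{\gamma;U}=\sup_{z\ne z'\in U}|w(z)-w(z')|/\varrho(z,z')^\gamma$, $\|w\|_{\gamma;U}=\|w\|_{L^\infty(U)}+[w]_{\gamma;U}$, $\|w\|_{2,\gamma;U}=\sum_{2q+|\alpha|\le2}\|\partial_t^qD_x^\alpha w\|_{\gamma;U}$; $C^{2,\gamma}(U)$ is the set of $w$ with this norm finite and these derivatives continuous. **Boundary assumptions.** (Q1) There are $0<\gamma\le1$ and $G,\zeta\in C^{2,\gamma}([0,T]\times\overline O)$ with $G=u_\partial$ and $\zeta=0$ on $[0,T]\times\partial O$, $\zeta>0$ on $[0,T)\times O$, $\zeta(T,\cdot)\ge0$ on $\overline O$. (Q2) There is $\beta>0$ such that for every $a\in A$, $\partial_t\zeta+\frac12\operatorname{Tr}(A^aD^2\zeta)+\mu^a\cdot D\zeta-r^a\zeta\le-\beta$ on $[0,T]\times O$. (Q3) There is $C_{\rm comp}>0$ with $|\Psi(x)-G(T,x)|\le C_{\rm comp}\zeta(T,x)$ for $x\in\overline O$. **HJB problem and viscosity solutions.** $\inf_{a\in A}F^a[u]=0$ in $Q_T$, $u=u_\partial$ on $[0,T)\times\partial O$, $u(T,\cdot)=\Psi$ on $\overline O$. Test functions are $C^{1,2}$; local extrema are relative to $Q_T^{\mathrm{cl}}$; at $t=0$ the time derivative is one-sided.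 A strong Dirichlet subsolution is an upper semicontinuous $v:Q_T^{\mathrm{cl}}\to\mathbb R$ such that $\inf_aF^a[\varphi](t,x)\ge0$ whenever $(t,x)\in Q_T$, $v-\varphi$ has a local maximum at $(t,x)$ and $v(t,x)=\varphi(t,x)$, and $v\le u_\partial$ on $[0,T)\times\partial O$, $v(T,\cdot)\le\Psi$ on $\overline O$. A strong supersolution is lower semicontinuous, with local minima, $\inf_aF^a[\varphi]\le0$, and $v\ge u_\partial$, $v(T,\cdot)\ge\Psi$. A strong solution is continuous and both. (If the bounded-domain data assumption, $r\ge0$, and (Q1)–(Q3) hold, then a unique bounded continuous strong solution exists.) **Cubature.** Fixed $M\ge1$, $\eta_j\in\mathbb R^p\setminus\{0\}$, $\rho_j>0$ ($1\le j\le M$) with $\sum_j\rho_j=1$, $\sum_j\rho_j\eta_j\eta_j^\top=I_p$, independent of mesh and control. **Mesh.** $O_h$ is a polyhedral approximation of $O$, $\mathcal T_h$ a simplicial triangulation of $O_h$ with vertex set $G_h=\{x_i:1\le i\le N_h\}$, $h=\max_{E\in\mathcal T_h}\operatorname{diam}E$, $\psi_i$ the $P_1$ nodal basis; $N_{\Delta t}\in\mathbb N$, $\Delta t=T/N_{\Delta t}$, $t_n=n\Delta t$. Constants $C_\partial,C_p,C_{\rm patch}$ do not depend on $h$. (G1) $G_h\cap\partial O_h=G_h\cap\partial O$ and all other vertices lie in $O$. (G2) Every boundary element has at most one face in $\partial O_h$. (G3) $\mathcal T_h$ is conforming with nondegenerate simplices. (G4) $d_H(\partial O,\partial O_h)\le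 C_\partial h^2$ (Hausdorff distance); there is a map $p_h:\overline O\to\overline O_h$ with $p_h(x_i)=x_i$, $\sup_x|p_h(x)-x|\le C_ph^2$; and with $\mathcal X_h\subset O$ the set of off-grid branch endpoints at which the scheme below evaluates $I^{\mathrm{sp}}$, for every $x\in\mathcal X_h$ and $\ell$ with $\psi_\ell(p_h(x))>0$: $|x_\ell-x|\le C_{\rm patch}h$, $[x,x_\ell]\subset\overline O$, $[x,x_\ell)\subset O$. Interpolation: $I^{\mathrm{sp}}[\Phi](x)=\sum_i\psi_i(p_h(x))\Phi(x_i)$; it satisfies $\sup_{x\in\mathcal X_h}|I^{\mathrm{sp}}[\varphi|_{G_h}](x)-\varphi(x)|\le C_Ih^2(\|D\varphi\|_\infty+\|D^2\varphi\|_\infty)$ for $\varphi\in C^2(\overline O)$, with $C_I=C_p+\frac12C_{\rm patch}^2$. **Scheme.** For $x_i\in G_h\cap O$, $n<N_{\Delta t}$, $a\in A$, let $\Gamma^{a,j,\pm}_{n,i}(q)=x_i+q\mu(t_n,x_i,a)\pm\sqrt q\,\sigma(t_n,x_i,a)\eta_j$, $0\le q\le\Delta t$. If $\{q\in(0,\Delta t]:\Gamma^{a,j,\pm}_{n,i}(q)\notin O\}$ is nonempty, $d_j^\pm$ is its infimum and $\chi_j^\pm=1$; otherwise $d_j^\pm=\Delta t$, $\chi_j^\pm=0$. Put $s_j^\pm=\sqrt{d_j^\pm}$, $\theta_j=s_j^+s_j^-$, $\tau_{n,i}(a)=(\sum_j\rho_j/\theta_j)^{-1}$, $\omega_j^\pm=\tau_{n,i}(a)\rho_j/\bigl(s_j^\pm(s_j^++s_j^-)\bigr)$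 (all depend on $n,i,a$). For $\Phi:G_h\to\mathbb R$ let $C_j^\pm[\Phi]=I^{\mathrm{sp}}[\Phi](\Gamma^{a,j,\pm}_{n,i}(\Delta t))$ if $\chi_j^\pm=0$; $=\Psi(\Gamma^{a,j,\pm}_{n,i}(d_j^\pm))$ if $\chi_j^\pm=1$, $t_n+d_j^\pm=T$; $=u_\partial(t_n+d_j^\pm,\Gamma^{a,j,\pm}_{n,i}(d_j^\pm))$ if $\chi_j^\pm=1$, $t_n+d_j^\pm<T$. Then $$S^a_{n,i}[\Phi]=\sum_{j,\pm}\omega_j^\pm\Bigl(\frac{C_j^\pm[\Phi]}{1+r(t_n,x_i,a)d_j^\pm}+f(t_n,x_i,a)d_j^\pm\Bigr),\qquad S_{n,i}[\Phi]=\inf_{a\in A}S^a_{n,i}[\Phi].$$ The discrete solution: $u_{h,i}^{N_{\Delta t}}=\Psi(x_i)$; for $n<N_{\Delta t}$, $u_{h,i}^n=u_\partial(t_n,x_i)$ if $x_i\in\partial O$ and $u_{h,i}^n=S_{n,i}[u_h^{n+1}]$ if $x_i\in O$. **Residual.** For a number $U_i^n$ and a grid function $U^{n+1}$ on $G_h$ (functions on $\overline O$ are restricted to $G_h$), $\mathcal R^a_{h,n,i}[U_i^n,U^{n+1}]=\bigl(S^a_{n,i}[U^{n+1}]-U_i^n\bigr)/\tau_{n,i}(a)$. *)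

(* Defs.v *)
From mathcomp Require Export all_boot all_order all_algebra.
From mathcomp Require Export all_classical all_reals all_analysis.

Set Implicit Arguments.
Unset Strict Implicit.
Unset Printing Implicit Defensive.

Export Order.TTheory GRing.Theory Num.Theory.
Export numFieldNormedType.Exports.

Local Open Scope classical_set_scope.
Local Open Scope ring_scope.

Section Geometry.
Context {R : realType}.

(* Euclidean norm of a vector, Frobenius norm of a matrix; the library norm
   `|A| of a matrix is the maximum norm, which induces the same topology. *)
Definition enorm m n (A : 'M[R]_(m, n)) : R :=
  Num.sqrt (\sum_(i < m) \sum_(j < n) A i j ^+ 2).

Definition dotp n (u v : 'cV[R]_n) : R := \sum_(i < n) u i 0 * v i 0.

Definition bdry (X : topologicalType) (S : set X) : set X :=
  closure S `\` interior S.

Definition bounded_domain n (O : set 'cV[R]_n) : Prop :=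
  [/\ open O, connected O, O !=set0 & bounded_set O].

Definition pdist n (z z' : R * 'cV[R]_n) : R :=
  enorm (z.2 - z'.2) + Num.sqrt `|z.1 - z'.1|.

Definition supnorm (X : Type) (U : set X) (w : X -> R) : \bar R :=
  ereal_sup [set (`|w z|)%:E | z in U].

Definition hoelder_seminorm n (g : R) (U : set (R * 'cV[R]_n))
    (w : R * 'cV[R]_n -> R) : \bar R :=
  ereal_sup [set e | exists z z', [/\ U z, U z', z <> z' &
    e = (`|w z - w z'| / pdist z z' `^ g)%:E]].

Definition hoelder_norm n g U (w : R * 'cV[R]_n -> R) : \bar R :=
  (supnorm U w + hoelder_seminorm g U w)%E.

Definition diam n (S : set 'cV[R]_n) : R :=
  sup [set d | exists x y, [/\ S x, S y & d = enorm (x - y)]].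

Definition hausdorff_dist n (S S' : set 'cV[R]_n) : \bar R :=
  maxe (ereal_sup [set ereal_inf [set (enorm (x - y))%:E | y in S'] | x in S])
       (ereal_sup [set ereal_inf [set (enorm (x - y))%:E | x in S] | y in S']).

End Geometry.

Section Regularity.
Context {R : realType} {N : nat}.
Notation V := 'cV[R]_N.

(* A function of (t, x) together with its derivatives.  For a function on
   [0, T] x cl(O) the derivatives on the lateral boundary are the continuous
   extensions of those on [0, T] x O (hence determined by jval), as usual for
   functions that are C^{1,2} up to the boundary of an arbitrary domain. *)
Record jet := Jet {
  jval :> R * V -> R ;
  jt : R * V -> R ;
  jx : R * V -> V ;
  jxx : R * V -> 'M[R]_N }.

(* The time derivative is taken within I, so it is one-sided at those
   endpoints of the interval I that belong to I. *)
Definition has_derivatives (I : set R) (O : set V) (w : jet) : Prop :=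
  forall t x, I t -> O x ->
  [/\ (fun s => (w (s, x) - w (t, x)) / (s - t)) @ within I (dnbhs t)
        --> jt w (t, x),
      forall i, is_derive x (delta_mx i 0 : V)
        (fun y => w (t, y)) (jx w (t, x) i 0) &
      forall i j, is_derive x (delta_mx j 0 : V)
        (fun y => jx w (t, y) i 0) (jxx w (t, x) i j)].

Definition jet_continuous (U : set (R * V)) (w : jet) : Prop :=
  [/\ {within U, continuous (jval w)}, {within U, continuous (jt w)},
      {within U, continuous (jx w)} & {within U, continuous (jxx w)}].

(* One summand for each multi-index (q, alpha) with 2 q + |alpha| <= 2. *)
Definition norm2g (g : R) (U : set (R * V)) (w : jet) : \bar R :=
  (hoelder_norm g U (jval w) + hoelder_norm g U (jt w)
   + \sum_(i < N) hoelder_norm g U (fun z => (jx w z i 0)%R)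
   + \sum_(i < N) \sum_(j < N | (i <= j)%N)
       hoelder_norm g U (fun z => jxx w z i j))%E.

Definition closed_cylinder (T : R) (O : set V) : set (R * V) :=
  `[0, T] `*` closure O.

(* w belongs to C^{2,g}([0, T] x cl(O)) *)
Definition C2g (T : R) (O : set V) (g : R) (w : jet) : Prop :=
  [/\ has_derivatives `[0, T] O w,
      jet_continuous (closed_cylinder T O) w &
      (norm2g g (closed_cylinder T O) w < +oo)%E].

(* w belongs to C^{1,2}([0, T) x O) *)
Definition C12 (T : R) (O : set V) (w : jet) : Prop :=
  has_derivatives `[0, T[ O w /\ jet_continuous (`[0, T[ `*` O) w.

End Regularity.
Arguments jet : clear implicits.

(* rate is the discount r, cost the running cost f, ubd the lateral datum
   u_bdry.  The coefficients are total functions; their values outside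
   [0, T] x cl(O) x A, cl(O) and [0, T] x bdry O are never used. *)
Record hjb_data (R : realType) (N p : nat) (A : Type) := HJBData {
  dom : set 'cV[R]_N ;
  horizon : R ;
  sigma : R * 'cV[R]_N -> A -> 'M[R]_(N, p) ;
  mu : R * 'cV[R]_N -> A -> 'cV[R]_N ;
  rate : R * 'cV[R]_N -> A -> R ;
  cost : R * 'cV[R]_N -> A -> R ;
  Psi : 'cV[R]_N -> R ;
  ubd : R * 'cV[R]_N -> R }.

Section HJB.
Context {R : realType} {N p : nat} {A : metricType R}.
Variable P : hjb_data R N p A.
Notation V := 'cV[R]_N.
Notation O := (dom P).
Notation T := (horizon P).

Definition QT : set (R * V) := `[0, T[ `*` O.
Definition Qcl : set (R * V) := closed_cylinder T O.
Definition lateral : set (R * V) := `[0, T] `*` bdry O.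

Definition bounded_domain_data : Prop :=
  exists K0 : R, 0 < K0 /\
  [/\ (supnorm (closure O) (Psi P) + supnorm lateral (ubd P)
       + ereal_sup [set (supnorm Qcl (fun z => enorm (sigma P z a))
                         + supnorm Qcl (fun z => enorm (mu P z a))
                         + supnorm Qcl (fun z => rate P z a)
                         + supnorm Qcl (fun z => cost P z a))%E | a in [set: A]]
       <= K0%:E)%E,
      forall x y, closure O x -> closure O y ->
        `|Psi P x - Psi P y| <= K0 * enorm (x - y),
      forall z z', lateral z -> lateral z' ->
        `|ubd P z - ubd P z'| <= K0 * pdist z z',
      forall z z' a, Qcl z -> Qcl z' ->
        [/\ enorm (sigma P z a - sigma P z' a) <= K0 * pdist z z',
            enorm (mu P z a - mu P z' a) <= K0 * pdist z z',
            `|rate P z a - rate P z' a| <= K0 * pdist z z' &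
            `|cost P z a - cost P z' a| <= K0 * pdist z z'] &
      forall z, Qcl z ->
        [/\ continuous (sigma P z), continuous (mu P z),
            continuous (rate P z) & continuous (cost P z)]].

(* F^a[w] without its source term f^a *)
Definition Lop (a : A) (w : jet R N) (z : R * V) : R :=
  jt w z + 2^-1 * \tr (sigma P z a *m (sigma P z a)^T *m jxx w z)
  + dotp (mu P z a) (jx w z) - rate P z a * w z.

Definition Fop (a : A) (w : jet R N) (z : R * V) : R := Lop a w z + cost P z a.

Definition infF (w : jet R N) (z : R * V) : R :=
  inf [set Fop a w z | a in [set: A]].

Definition strong_subsolution (v : R * V -> R) : Prop :=
  [/\ lower_semicontinuous (fun z : subspace Qcl => (- v z)%:E),
      forall (phi : jet R N) z, C12 T O phi -> QT z ->
        (\forall z' \near within Qcl (nbhs z), v z' - phi z' <= v z - phi z) ->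
        v z = phi z -> 0 <= infF phi z,
      forall z, (`[0, T[ `*` bdry O) z -> v z <= ubd P z &
      forall x, closure O x -> v (T, x) <= Psi P x].

Definition strong_supersolution (v : R * V -> R) : Prop :=
  [/\ lower_semicontinuous (fun z : subspace Qcl => (v z)%:E),
      forall (phi : jet R N) z, C12 T O phi -> QT z ->
        (\forall z' \near within Qcl (nbhs z), v z - phi z <= v z' - phi z') ->
        v z = phi z -> infF phi z <= 0,
      forall z, (`[0, T[ `*` bdry O) z -> ubd P z <= v z &
      forall x, closure O x -> Psi P x <= v (T, x)].

Definition strong_solution (v : R * V -> R) : Prop :=
  [/\ {within Qcl, continuous v}, strong_subsolution v
    & strong_supersolution v].

Definition Q1 (g : R) (G zeta : jet R N) : Prop :=
  [/\ 0 < g <= 1, C2g T O g G, C2g T O g zeta,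
      forall z, lateral z -> G z = ubd P z /\ zeta z = 0 &
      (forall z, QT z -> 0 < zeta z) /\
      (forall x, closure O x -> 0 <= zeta (T, x))].

Definition Q2 (zeta : jet R N) (beta : R) : Prop :=
  0 < beta /\
  forall a z, (`[0, T] `*` O) z -> Lop a zeta z <= - beta.

Definition Q3 (G zeta : jet R N) (Ccomp : R) : Prop :=
  0 < Ccomp /\
  forall x, closure O x -> `|Psi P x - G (T, x)| <= Ccomp * zeta (T, x).

Definition CG (G : jet R N) : R :=
  sup [set c | exists z a, Qcl z /\ c = `|Fop a G z|].

End HJB.

Record cubature (R : realType) (p : nat) := Cubature {
  cM : nat ;
  eta : 'I_cM -> 'cV[R]_p ;
  wt : 'I_cM -> R }.
Arguments eta {R p} c j.
Arguments wt {R p} c j.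

Definition cubature_ok (R : realType) (p : nat) (c : cubature R p) : Prop :=
  [/\ (0 < cM c)%N, forall j, eta c j != 0, forall j, 0 < wt c j,
      \sum_j wt c j = 1 &
      \sum_j wt c j *: (eta c j *m (eta c j)^T) = 1%:M].

(* vtx enumerates G_h; an element of the triangulation is given by the set of
   indices of its N + 1 vertices; domh is O_h, hat the nodal basis, proj p_h. *)
Record mesh (R : realType) (N : nat) := Mesh {
  nv : nat ;
  vtx : 'I_nv -> 'cV[R]_N ;
  elts : {set {set 'I_nv}} ;
  domh : set 'cV[R]_N ;
  hat : 'I_nv -> 'cV[R]_N -> R ;
  proj : 'cV[R]_N -> 'cV[R]_N }.
Arguments vtx {R N} m k.
Arguments hat {R N} m k x.

Section MeshHypotheses.
Context {R : realType} {N : nat}.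
Variable m : mesh R N.
Notation V := 'cV[R]_N.

Definition bary (E : {set 'I_(nv m)}) (l : 'I_(nv m) -> R) : Prop :=
  [/\ forall k, 0 <= l k, \sum_k l k = 1 & forall k, k \notin E -> l k = 0].

Definition hull (E : {set 'I_(nv m)}) : set V :=
  [set x | exists2 l, bary E l & x = \sum_k l k *: vtx m k].

Definition meshsize : R := \big[Num.max/0]_(E in elts m) diam (hull E).

(* The simplices are nondegenerate (affinely independent vertices) and two of
   them meet exactly in the face spanned by their common vertices. *)
Definition triangulation : Prop :=
  [/\ injective (vtx m),
      forall k, exists2 E, E \in elts m & k \in E,
      forall E, E \in elts m -> #|E| = N.+1 /\
        (forall l : 'I_(nv m) -> R, (forall k, k \notin E -> l k = 0) ->
           \sum_k l k = 0 -> \sum_k l k *: vtx m k = 0 -> forall k, l k = 0),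
      forall E E', E \in elts m -> E' \in elts m ->
        hull E `&` hull E' = hull (E :&: E') &
      open (domh m) /\
      closure (domh m) = [set x | exists2 E, E \in elts m & hull E x]].

(* Affine on each element, with nodal values hat i (x_k) = delta_ik; this
   determines hat i on cl(O_h). *)
Definition nodal_basis : Prop :=
  forall i, (forall k, hat m i (vtx m k) = (i == k)%:R) /\
  forall E l, E \in elts m -> bary E l ->
    hat m i (\sum_k l k *: vtx m k) = \sum_k l k * hat m i (vtx m k).

Definition mesh_G1 (O : set V) : Prop :=
  [/\ range (vtx m) `&` bdry (domh m) = range (vtx m) `&` bdry O &
      forall i, ~ bdry (domh m) (vtx m i) -> O (vtx m i)].

(* The faces of E are the hulls of E :\ i, i in E. *)
Definition mesh_G2 : Prop :=
  forall E i j, E \in elts m -> i \in E -> j \in E ->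
    hull (E :\ i) `<=` bdry (domh m) -> hull (E :\ j) `<=` bdry (domh m) ->
    i = j.

Definition mesh_G4 (O : set V) (Cbd Cp : R) : Prop :=
  [/\ (hausdorff_dist (bdry O) (bdry (domh m)) <= (Cbd * meshsize ^+ 2)%:E)%E,
      forall x, closure O x -> closure (domh m) (proj m x),
      forall i, proj m (vtx m i) = vtx m i &
      forall x, closure O x -> enorm (proj m x - x) <= Cp * meshsize ^+ 2].

Definition interp (Phi : 'I_(nv m) -> R) (x : V) : R :=
  \sum_i hat m i (proj m x) * Phi i.

End MeshHypotheses.

Section Scheme.
Context {R : realType} {N p : nat} {A : metricType R}.
Variables (P : hjb_data R N p A) (c : cubature R p) (m : mesh R N).
Variable Nt : nat.
Notation V := 'cV[R]_N.
Notation O := (dom P).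
Notation T := (horizon P).

Definition dt : R := T / Nt%:R.
Definition tn (n : nat) : R := n%:R * dt.

Section Row.
Variables (n : nat) (i : 'I_(nv m)) (a : A).
Let z : R * V := (tn n, vtx m i).

(* The sign of a branch is a boolean: false is +, true is -. *)
Definition branch (j : 'I_(cM c)) (b : bool) (q : R) : V :=
  vtx m i + q *: mu P z a
  + ((-1) ^+ b * Num.sqrt q) *: (sigma P z a *m eta c j).

Definition exits j b : set R :=
  [set q | 0 < q <= dt /\ ~ O (branch j b q)].

Definition stopped j b : bool := `[< exits j b !=set0 >].

Definition exit_time j b : R := if stopped j b then inf (exits j b) else dt.

Definition sroot j b : R := Num.sqrt (exit_time j b).

Definition theta j : R := sroot j false * sroot j true.

Definition tau : R := (\sum_j wt c j / theta j)^-1.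

Definition omega j b : R :=
  tau * wt c j / (sroot j b * (sroot j false + sroot j true)).

Definition continuation (Phi : 'I_(nv m) -> R) j b : R :=
  let d := exit_time j b in
  if stopped j b then
    if tn n + d == T then Psi P (branch j b d)
    else ubd P (tn n + d, branch j b d)
  else interp Phi (branch j b dt).

Definition Sa (Phi : 'I_(nv m) -> R) : R :=
  \sum_j \sum_(b : bool) omega j b *
    (continuation Phi j b / (1 + rate P z a * exit_time j b)
     + cost P z a * exit_time j b).

Definition residual (U : R) (Phi : 'I_(nv m) -> R) : R := (Sa Phi - U) / tau.

End Row.

Definition Sinf (n : nat) (i : 'I_(nv m)) (Phi : 'I_(nv m) -> R) : R :=
  inf [set Sa n i a Phi | a in [set: A]].

Definition discrete_solution (u : nat -> 'I_(nv m) -> R) : Prop :=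
  (forall i, u Nt i = Psi P (vtx m i)) /\
  forall n i, (n < Nt)%N ->
    (bdry O (vtx m i) -> u n i = ubd P (tn n, vtx m i)) /\
    (O (vtx m i) -> u n i = Sinf n i (u n.+1)).

(* The off-grid points at which the scheme evaluates the interpolation. *)
Definition Xh : set V :=
  [set x | ~ range (vtx m) x /\
    exists n i a j b, [/\ (n < Nt)%N, O (vtx m i), ~~ stopped n i a j b &
      x = branch n i a j b dt]].

Definition mesh_patch (Cpatch : R) : Prop :=
  forall x l, Xh x -> 0 < hat m l (proj m x) ->
    [/\ enorm (vtx m l - x) <= Cpatch * meshsize m,
        forall s, 0 <= s <= 1 -> closure O ((1 - s) *: x + s *: vtx m l) &
        forall s, 0 <= s < 1 -> O ((1 - s) *: x + s *: vtx m l)].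

Definition mesh_ok (Cbd Cp Cpatch : R) : Prop :=
  [/\ triangulation m, nodal_basis m & mesh_G1 m O] /\
  [/\ mesh_G2 m, mesh_G4 m O Cbd Cp & mesh_patch Cpatch].

End Scheme.

(* Main.v *)
Require Import Defs.
From mathcomp Require Import ring lra.

(** The functions Phi+ = G + K zeta and Phi- = G - K zeta are smooth strict
   barriers: (Q2) and the choice of K give F^a[Phi+] <= C_G - K beta <= -2 and
   F^a[Phi-] >= 2 for every control a.  Both take the lateral data u_bdry, and
   by (Q3) they enclose Psi at the final time.

   Residuals.  It suffices to show that the residual of a function w of class
   C^{2,g} with the right boundary values differs from F^a[w] by
   O(dt^(g/2) + h^2/dt), uniformly in the row and the control
   (residual_consistency).  Along a branch x + q mu + sqrt q sigma eta_j that
   stops at time d, the expansion of w has the error O(d^(1 + g/2))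
   (jet_branch_bounds).  The branch stays in the domain up to time d although
   segments between its points may not, so the expansion is done in the
   parameter s = sqrt q of the branch (parabola_taylor).  A stopped branch ends
   on the boundary and reads the exact value of w there; a full branch has
   d = dt and an interpolation error O(h^2) = O(d h^2/dt).  The weights cancel
   the terms of order sqrt d, even for a pair of branches that stop at different
   times, and average d to tau; the cubature turns the quadratic terms into
   the trace (weighted_expansion, cubature_quadf).

   Barriers.  If the consistency error is at most 1/2, then Phi+ and Phi- are a
   super- and a subsolution of the scheme, which is monotone, so the discrete
   bounds follow by backward induction (discrete_comparison).  For the viscosity
   solution u, a positive maximum of u - Phi+ would be interior, where Phi+
   plus a constant is a test function that contradicts F^a[Phi+] < 0
   (subsolution_le_smooth, and smooth_le_supersolution for Phi-). *)

Set Implicit Arguments.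
Unset Strict Implicit.
Unset Printing Implicit Defensive.

Local Open Scope classical_set_scope.
Local Open Scope ring_scope.

(** * Differential calculus along curves *)

Section MeanValue.
Context {R : realType}.

Lemma mean_value_bound (F dF : R -> R) (a b m e : R) :
  (forall s, Num.min a b <= s <= Num.max a b -> is_derive s 1 F (dF s)) ->
  (forall s, Num.min a b <= s <= Num.max a b -> `|dF s - m| <= e) ->
  `|F b - F a - m * (b - a)| <= e * `|b - a|.
Proof.
wlog ab : a b / a <= b => [th dFE dFm|].
  have [/th|/ltW ba] := leP a b; first exact.
  rewrite -normrN (distrC b a).
  have -> : - (F b - F a - m * (b - a)) = F a - F b - m * (a - b) by ring.
  by apply: th => // s; rewrite minC maxC => ?; [exact: dFE|exact: dFm].
rewrite (min_idPl _)// (max_idPr _)// => dFE dFm.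
have cF : {within `[a, b], continuous F}.
  apply: derivable_within_continuous => s; rewrite in_itv/= => sab.
  by have [] := dFE s sab.
have [|c + ->] := @MVT_segment _ F dF a b ab _ cF.
  by move=> s; rewrite in_itv/= => /andP[/ltW ? /ltW ?]; apply: dFE; apply/andP.
rewrite in_itv/= => /dFm cm.
by rewrite -mulrBl normrM ler_wpM2r.
Qed.

End MeanValue.

Section Frechet.
Context {R : realType} {N : nat}.
Notation V := 'cV[R]_N.

Lemma ler_norm_entry m n (M : 'M[R]_(m, n)) i j : `|M i j| <= `|M|.
Proof.
rewrite [leRHS]/Num.norm/= mx_normrE.
exact: (le_bigmax _ (fun ij => `|M ij.1 ij.2|) (i, j)).
Qed.

Lemma mx_norm_leP m n (M : 'M[R]_(m, n)) e : 0 <= e ->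
  (forall i j, `|M i j| <= e) -> `|M| <= e.
Proof.
move=> e0 Me; rewrite [leLHS]/Num.norm/= mx_normrE.
by apply/bigmax_leP; split => // -[i j] _; exact: Me.
Qed.

Lemma is_derive_line (f : V -> R) (y v : V) (s df : R) :
  is_derive (y + s *: v) v f df -> is_derive s 1 (fun r : R => f (y + r *: v)) df.
Proof.
have E : (fun h => h^-1 *: ((f \o shift (y + s *: v)) (h *: v) - f (y + s *: v)))
   = (fun h : R => h^-1 *: (((fun r : R => f (y + r *: v)) \o shift s) (h *: 1)
      - f (y + s *: v))).
  apply/funext => h /=; congr (_ *: (f _ - _)).
  by rewrite [h *: 1]mulr1 scalerDl addrCA addrA addrC addrA.
by case; rewrite /derivable /derive E => ? ?; split.
Qed.

(** Continuous partial derivatives give differentiability: the increment is a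
   sum of increments in one coordinate each, to which the mean value estimate
   applies. *)
Lemma partials_expansion (f : V -> R) (D : V -> V) (x : V) (r e : R) :
  (forall y : V, `|y - x| < r -> forall i, is_derive y (delta_mx i 0 : V) f (D y i 0)) ->
  (forall y : V, `|y - x| < r -> `|D y - D x| <= e) ->
  forall h : V, `|h| < r ->
  `|f (x + h) - f x - dotp (D x) h| <= (N%:R * e) * `|h|.
Proof.
move=> fD De h hr.
(* the corners of the path from x to x + h along the coordinate axes *)
pose part (k : nat) : V := \col_i (if (i < k)%N then h i 0 else 0).
have r0 : 0 < r by exact: le_lt_trans hr.
have e0 : 0 <= e.
  by have := De x; rewrite !subrr !normr0 => /(_ r0).
have partle k (s : R) (i : 'I_N) : Num.min 0 (h i 0) <= s <= Num.max 0 (h i 0) ->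
    k = i -> `|part k + s *: delta_mx i 0| <= `|h|.
  move=> sh ->; apply: mx_norm_leP => // j c.
  rewrite !mxE ord1 eqxx andbT; case: ltngtP => [ji|ji|/val_inj->].
  - have -> : (j == i) = false by apply/negbTE; rewrite neq_ltn ji.
    by rewrite mulr0 addr0; exact: ler_norm_entry.
  - have -> : (j == i) = false by apply/negbTE; rewrite neq_ltn ji orbT.
    by rewrite mulr0 addr0 normr0.
  - rewrite eqxx mulr1 add0r; apply: (@le_trans _ _ `|h i 0|); last exact: ler_norm_entry.
    rewrite ler_norml; move: sh; case: (leP 0 (h i 0)) => hi /andP[s1 s2].
      by rewrite ger0_norm// s2 andbT (le_trans _ s1)// oppr_le0.
    by rewrite ltr0_norm// opprK s1 (le_trans s2)// oppr_ge0 ltW.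
have part0 : part 0%N = 0 by apply/colP => i; rewrite !mxE.
have partN : part N = h by apply/colP => i; rewrite !mxE ltn_ord.
have partS (i : 'I_N) : part i.+1 = part i + h i 0 *: delta_mx i 0.
  apply/colP => j; rewrite !mxE eqxx andbT ltnS leq_eqVlt -val_eqE.
  have [/= /eqP/val_inj->|] := boolP (val j == val i).
    by rewrite ltnn mulr1 add0r.
  by move=> _; rewrite mulr0 addr0.
have step (i : 'I_N) :
    `|f (x + part i.+1) - f (x + part i) - D x i 0 * h i 0| <= e * `|h|.
  have hs (s : R) : Num.min 0 (h i 0) <= s <= Num.max 0 (h i 0) ->
      `|x + part i + s *: delta_mx i 0 - x| < r.
    move=> sh; rewrite addrAC [x + _ - x]addrAC subrr add0r.
    exact: le_lt_trans (partle i s i sh erefl) hr.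
  have := @mean_value_bound _ (fun s => f (x + part i + s *: delta_mx i 0))
    (fun s => D (x + part i + s *: delta_mx i 0) i 0) 0 (h i 0) (D x i 0) e.
  rewrite subr0 scale0r addr0 -(addrA _ (part i)) -partS; move=> th.
  apply: le_trans (th _ _) _.
  - by move=> s sh; apply: is_derive_line; apply: fD; exact: hs.
  - move=> s sh; apply: le_trans (De _ (hs _ sh)).
    have := ler_norm_entry (D (x + part i + s *: delta_mx i 0) - D x) i 0.
    by rewrite !mxE.
  - by rewrite ler_wpM2l// ler_norm_entry.
have -> : f (x + h) - f x - dotp (D x) h =
    \sum_(i < N) (f (x + part i.+1) - f (x + part i) - D x i 0 * h i 0).
  rewrite big_split/= /dotp -sumrN; congr (_ + _).
  rewrite -(big_mkord xpredT (fun i => f (x + part i.+1) - f (x + part i))).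
  by rewrite telescope_sumr// part0 partN addr0.
apply: le_trans (ler_norm_sum _ _ _) _.
apply: le_trans (ler_sum _ (fun i _ => step i)) _.
by rewrite sumr_const card_ord -mulrA mulr_natl.
Qed.

End Frechet.

Section Taylor.
Context {R : realType}.

Lemma is_derive_eps (F : R -> R) (s L : R) :
  (forall e : R, 0 < e -> exists2 r : R, 0 < r &
     forall h : R, `|h| < r -> `|F (s + h) - F s - h * L| <= e * `|h|) ->
  is_derive s 1 F L.
Proof.
move=> Fe.
have cvF : (fun h => h^-1 *: ((F \o shift s) (h *: 1) - F s)) @ 0^' --> L.
  apply/cvgrPdist_le => e /Fe[r r0 Fr].
  have nr : \forall h \near (0 : R), `|h| < r by exact: nbhs0_lt.
  near=> h; have h0 : h != 0 by near: h; exact: nbhs_dnbhs_neq.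
  have h_gt0 : 0 < `|h| by rewrite normr_gt0.
  rewrite distrC /= [h *: 1]mulr1 (addrC h) [_ *: _]mulrC.
  have -> : (F (s + h) - F s) / h - L = (F (s + h) - F s - h * L) / h.
    by field.
  rewrite normrM normfV ler_pdivrMr//; apply: Fr.
  by near: h; exact: nbhs_dnbhs nr.
by split; [apply/cvg_ex; exists L|exact: (cvg_lim _ cvF)].
Unshelve. all: by end_near. Qed.

Lemma taylor2_bound (psi psi1 psi2 : R -> R) (M s : R) : 0 <= s ->
  (forall r : R, 0 <= r <= s -> is_derive r 1 psi (psi1 r)) ->
  (forall r : R, 0 <= r <= s -> is_derive r 1 psi1 (psi2 r)) ->
  (forall r : R, 0 <= r <= s -> `|psi2 r - psi2 0| <= M) ->
  `|psi s - psi 0 - s * psi1 0 - s ^+ 2 / 2 * psi2 0| <= M * s ^+ 2.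
Proof.
move=> s0 d1 d2 bM.
have M0 : 0 <= M.
  by apply: le_trans (bM 0 _); rewrite ?normr_ge0// lexx s0.
have step (r : R) : 0 <= r <= s -> `|psi1 r - r * psi2 0 - psi1 0| <= M * s.
  move=> /andP[r0 rs].
  have := @mean_value_bound _ psi1 psi2 0 r (psi2 0) M.
  rewrite (min_idPl r0) (max_idPr r0) subr0 (ger0_norm r0) => th.
  rewrite addrAC [r * _]mulrC; apply: le_trans (th _ _) _.
  - by move=> q /andP[q0 qr]; apply: d2; rewrite q0 (le_trans qr).
  - by move=> q /andP[q0 qr]; apply: bM; rewrite q0 (le_trans qr).
  - by rewrite ler_wpM2l.
have := @mean_value_bound _ (fun r => psi r - r ^+ 2 / 2 * psi2 0)
  (fun r => psi1 r - r * psi2 0) 0 s (psi1 0) (M * s).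
rewrite (min_idPl s0) (max_idPr s0) subr0 (ger0_norm s0) => th.
have -> : psi s - psi 0 - s * psi1 0 - s ^+ 2 / 2 * psi2 0 =
  psi s - s ^+ 2 / 2 * psi2 0 - (psi 0 - 0 ^+ 2 / 2 * psi2 0) - psi1 0 * s.
  by rewrite expr0n/=; ring.
rewrite expr2 mulrA; apply: th => // r /d1 dr.
have dq : is_derive r 1 (fun r0 : R => r0 ^+ 2 / 2 * psi2 0) (r * psi2 0).
  rewrite (_ : (fun _ => _) = (psi2 0 / 2) \*: (@GRing.exp R ^~ 2%N)); last first.
    by apply/funext => q/=; rewrite /GRing.scale/=; field.
  have := is_deriveZ (psi2 0 / 2)
    (DeriveDef (@exprn_derivable R 2 r 1) (exp_derive 2 r 1)).
  by move/is_derive_eq; apply; rewrite /GRing.scale/= expr1 mulr1; field.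
exact: is_deriveB.
Qed.

End Taylor.

Section BallContinuity.
Context {R : realType} {U W : normedModType R}.

Lemma continuous_at_ball (D : U -> W) (y : U) :
  (forall e : R, 0 < e -> exists2 r : R, 0 < r &
    forall y', `|y' - y| < r -> `|D y' - D y| <= e) -> {for y, continuous D}.
Proof.
move=> De; apply/cvgrPdistC_le => e /De[r r0 rP].
by apply/nbhs_normP; exists r => // y' yy'; apply: rP; rewrite distrC.
Qed.

Lemma open_ball_continuous (O : set U) (D : U -> W) (y : U) (e : R) :
  open O -> O y -> {for y, continuous D} -> 0 < e ->
  exists2 r : R, 0 < r &
    forall y', `|y' - y| < r -> O y' /\ `|D y' - D y| <= e.
Proof.
move=> oO Oy cD e0.
have nD : \forall y' \near y, `|D y' - D y| <= e.
  by move/cvgrPdistC_le : cD; apply.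
have nO : \forall y' \near y, O y' by exact: open_nbhs_nbhs.
have /nbhs_normP[r /= r0 rP] : \forall y' \near y, O y' /\ `|D y' - D y| <= e.
  by near=> y'; split; near: y'.
by exists r => // y' y'r; apply: rP; rewrite /ball_/= distrC.
Unshelve. all: by end_near. Qed.

Lemma within_continuous_ball (K : set U) (D : U -> W) (y : U) (e : R) :
  {within K, continuous D} -> K y -> 0 < e ->
  exists2 r : R, 0 < r & forall y', K y' -> `|y' - y| < r -> `|D y' - D y| <= e.
Proof.
move=> /subspace_continuousP/(_ y) cD /cD /cvgrPdistC_le De /De/nbhs_normP[r r0 rP].
by exists r => // y' Ky' y'r; apply: rP => //; rewrite /ball_/= distrC.
Qed.

End BallContinuity.

Section C2.
Context {R : realType} {N : nat}.
Notation V := 'cV[R]_N.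

Lemma dotpDr (u v w : V) : dotp u (v + w) = dotp u v + dotp u w.
Proof. by rewrite /dotp -big_split; apply: eq_bigr => i _; rewrite mxE mulrDr. Qed.

Lemma dotpZr (k : R) (u v : V) : dotp u (k *: v) = k * dotp u v.
Proof.
by rewrite /dotp mulr_sumr; apply: eq_bigr => i _; rewrite mxE mulrCA.
Qed.

Lemma dotpC (u v : V) : dotp u v = dotp v u.
Proof. by apply: eq_bigr => i _; rewrite mulrC. Qed.

Lemma dotpBl (u v w : V) : dotp (u - v) w = dotp u w - dotp v w.
Proof. by rewrite dotpC dotpDr -scaleN1r dotpZr mulN1r !(dotpC w). Qed.

Lemma dotp_le (u v : V) : `|dotp u v| <= N%:R * (`|u| * `|v|).
Proof.
apply: le_trans (ler_norm_sum _ _ _) _.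
have le1 (i : 'I_N) : `|u i 0 * v i 0| <= `|u| * `|v|.
  by rewrite normrM ler_pM// ler_norm_entry.
apply: le_trans (ler_sum _ (fun i _ => le1 i)) _.
by rewrite sumr_const card_ord mulr_natl.
Qed.

Definition C1_on (O : set V) (f : V -> R) (D : V -> V) :=
  (forall y i, O y -> is_derive y (delta_mx i 0 : V) f (D y i 0)) /\
  (forall y, O y -> {for y, continuous D}).

Definition C2_on (O : set V) (f : V -> R) (D : V -> V) (H : V -> 'M[R]_N) :=
  [/\ C1_on O f D,
      forall y i j, O y ->
        is_derive y (delta_mx j 0 : V) (fun y' => D y' i 0) (H y i j)
    & forall y, O y -> {for y, continuous H}].

(** A branch of the scheme in the variable s = sqrt q, in which it is smooth
   down to s = 0. *)
Definition parabola (x mu v : V) (s : R) : V := x + s ^+ 2 *: mu + s *: v.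

Definition quadf (H : 'M[R]_N) (v : V) : R := dotp (H *m v) v.

Lemma chain_rule_parabola (O : set V) f D (x mu v : V) (s : R) :
  open O -> C1_on O f D -> O (parabola x mu v s) ->
  is_derive s 1 (fun r => f (parabola x mu v r))
    (dotp (D (parabola x mu v s)) ((2 * s) *: mu + v)).
Proof.
move=> oO [fD cD] Oy; set y := parabola x mu v s.
set K := (2 * `|s| + 1) * `|mu| + `|v| + 1.
have K0 : 0 < K by rewrite ltr_wpDl// addr_ge0// mulr_ge0// addr_ge0// mulr_ge0.
have parabolaD (h : R) : parabola x mu v (s + h) =
    y + h *: ((2 * s + h) *: mu + v).
  rewrite /y /parabola scalerDr scalerA [(s + h) *: v]scalerDl.
  rewrite (_ : (s + h) ^+ 2 = s ^+ 2 + h * (2 * s + h)); last by ring.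
  by rewrite scalerDl !addrA; congr (_ + _); rewrite addrAC.
have hK (h : R) : `|h| <= 1 -> `|h *: ((2 * s + h) *: mu + v)| <= `|h| * K.
  move=> h1; rewrite normrZ ler_wpM2l// (le_trans (ler_normD _ _))//.
  rewrite normrZ -[leLHS]addr0 lerD// lerD// ler_wpM2r//.
  by rewrite (le_trans (ler_normD _ _))// normrM ger0_norm// lerD.
apply: is_derive_eps => e e0.
pose e1 := e / 2 / (N.+1%:R * K).
have e10 : 0 < e1 by rewrite !divr_gt0// mulr_gt0.
have [r r0 rP] := open_ball_continuous oO Oy (cD _ Oy) e10.
pose L := N%:R * (`|D y| * `|mu|) + 1.
have L0 : 0 < L by rewrite ltr_wpDl// !mulr_ge0.
exists (Num.min 1 (Num.min (r / K) (e / 2 / L))).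
  by rewrite !lt_min ltr01 !divr_gt0.
move=> h; rewrite !lt_min => /and3P[/ltW h1 hr he].
rewrite parabolaD; set k := h *: _.
have kr : `|k| < r.
  by apply: le_lt_trans (hK h h1) _; rewrite -ltr_pdivlMr.
have := @partials_expansion _ _ f D y r e1.
move=> /(_ (fun y' y'r i => fD y' i (rP y' y'r).1)).
move=> /(_ (fun y' y'r => (rP y' y'r).2) k kr) => Hk.
have -> : f (y + k) - f y - h * dotp (D y) ((2 * s) *: mu + v) =
    (f (y + k) - f y - dotp (D y) k) + h * (h * dotp (D y) mu).
  by rewrite /k !(dotpZr, dotpDr); ring.
apply: le_trans (ler_normD _ _) _.
rewrite [e]splitr mulrDl; apply: lerD.
  apply: le_trans Hk _; apply: le_trans (ler_wpM2l _ (hK h h1)) _.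
    by rewrite mulr_ge0// ltW.
  have -> : e / 2 = e1 * (N.+1%:R * K) by rewrite /e1 divfK// gt_eqF// mulr_gt0.
  have -> : e1 * (N.+1%:R * K) * `|h| = N.+1%:R * e1 * (`|h| * K) by ring.
  apply: ler_wpM2r; first by rewrite mulr_ge0// ltW.
  by rewrite ler_wpM2r ?ler_nat// ltW.
rewrite normrM mulrC ler_wpM2r// normrM.
rewrite ltr_pdivlMr// in he; apply: le_trans (ltW he).
by rewrite ler_wpM2l// (le_trans (dotp_le _ _))// lerDl.
Qed.

(** The second difference is symmetric in i and j, while either order of taking
   the two increments compares it with a different mixed derivative. *)
Lemma second_difference (f : V -> R) (D : V -> V) (H : V -> 'M[R]_N) (y : V)
  (r e u : R) (i j : 'I_N) :
  (forall y' : V, `|y' - y| < r -> is_derive y' (delta_mx i 0 : V) f (D y' i 0)) ->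
  (forall y' : V, `|y' - y| < r ->
     is_derive y' (delta_mx j 0 : V) (fun y' => D y' i 0) (H y' i j)) ->
  (forall y' : V, `|y' - y| < r -> `|H y' i j - H y i j| <= e) ->
  0 < u -> 2 * u < r ->
  `|f (y + u *: delta_mx j 0 + u *: delta_mx i 0) - f (y + u *: delta_mx j 0)
    - (f (y + u *: delta_mx i 0) - f y) - u * u * H y i j| <= e * u * u.
Proof.
move=> fD DH He u0 ur.
have nd (k : 'I_N) : `|delta_mx k 0 : V| <= 1.
  by apply: mx_norm_leP => // k' c; rewrite mxE normr_nat lern1 leq_b1.
have inb (a b : R) : 0 <= a <= u -> 0 <= b <= u ->
    `|y + a *: delta_mx j 0 + b *: delta_mx i 0 - y| < r.
  move=> /andP[a0 au] /andP[b0 bu]; rewrite addrAC [y + _ - y]addrAC subrr add0r.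
  apply: le_lt_trans ur; rewrite mulr_natl mulr2n.
  apply: le_trans (ler_normD _ _) _.
  by apply: lerD; rewrite normrZ ger0_norm// -[leRHS]mulr1 ler_pM.
have u_itv : 0 <= u <= u by rewrite lexx ltW.
have z_itv : (0 : R) <= 0 <= u by rewrite lexx ltW.
have step (s : R) : 0 <= s <= u ->
    `|D (y + u *: delta_mx j 0 + s *: delta_mx i 0) i 0
      - D (y + s *: delta_mx i 0) i 0 - u * H y i j| <= e * u.
  move=> su.
  have := @mean_value_bound _
    (fun q => D (y + s *: delta_mx i 0 + q *: delta_mx j 0) i 0)
    (fun q => H (y + s *: delta_mx i 0 + q *: delta_mx j 0) i j) 0 u (H y i j) e.
  rewrite (min_idPl (ltW u0)) (max_idPr (ltW u0)) subr0 (gtr0_norm u0).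
  rewrite scale0r addr0 (addrAC y (u *: _)) (mulrC u (H y i j)); apply.
    move=> q qu; apply: (@is_derive_line _ _ (fun z => D z i 0)); apply: DH.
    by rewrite (addrAC y); exact: inb.
  by move=> q qu; apply: He; rewrite (addrAC y); exact: inb.
have := @mean_value_bound _
    (fun s => f (y + u *: delta_mx j 0 + s *: delta_mx i 0)
              - f (y + s *: delta_mx i 0))
    (fun s => D (y + u *: delta_mx j 0 + s *: delta_mx i 0) i 0
              - D (y + s *: delta_mx i 0) i 0) 0 u (u * H y i j) (e * u).
rewrite (min_idPl (ltW u0)) (max_idPr (ltW u0)) subr0 (gtr0_norm u0).
rewrite !scale0r !addr0 => th.
have -> : u * u * H y i j = u * H y i j * u by ring.
set A := f _ in th *; set B := f (y + _) in th *.
have -> : A - f (y + u *: delta_mx j 0) - (B - f y) =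
  A - B - (f (y + u *: delta_mx j 0) - f y) by ring.
apply: th => s su; last exact: step.
have d1 := fD _ (inb u s u_itv su).
have := fD _ (inb 0 s z_itv su); rewrite scale0r addr0 => d2.
by have := is_deriveB (is_derive_line d1) (is_derive_line d2).
Qed.

Lemma second_partials_symmetric (O : set V) f D H (y : V) (i j : 'I_N) :
  open O -> C2_on O f D H -> O y -> H y i j = H y j i.
Proof.
move=> oO [[fD _] DH cH] Oy; apply/eqP; rewrite -subr_eq0 -normr_le0.
apply/ler_addgt0Pl => e e0; rewrite addr0.
have e2 : 0 < e / 2 by rewrite divr_gt0.
have [r r0 rP] := open_ball_continuous oO Oy (cH _ Oy) e2.
have u0 : 0 < r / 4 by rewrite divr_gt0.
have ur : 2 * (r / 4) < r by rewrite mulrCA gtr_pMr// ltr_pdivrMr// mul1r ltr_nat.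
have He (k l : 'I_N) (y' : V) : `|y' - y| < r -> `|H y' k l - H y k l| <= e / 2.
  move=> /rP[_]; apply: le_trans.
  by have := ler_norm_entry (H y' - H y) k l; rewrite !mxE.
have dd (k l : 'I_N) := @second_difference f D H y r (e / 2) (r / 4) k l
  (fun y' y'r => fD y' k (rP y' y'r).1) (fun y' y'r => DH y' k l (rP y' y'r).1)
  (He k l) u0 ur.
move: (dd i j) (dd j i); rewrite (addrAC y); set u := r / 4.
set A := f _; set B := f _; set C := f _ => h1 h2.
rewrite -(@ler_pM2l _ (u * u)) ?mulr_gt0// -[X in X * `|_|]gtr0_norm ?mulr_gt0//.
rewrite -normrM.
have -> : u * u * (H y i j - H y j i) =
  (A - C - (B - f y) - u * u * H y j i) - (A - B - (C - f y) - u * u * H y i j).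
  by ring.
apply: le_trans (ler_normB _ _) _.
apply: le_trans (lerD h2 h1) _.
by rewrite (_ : _ + _ = u * u * e)//; field.
Qed.

(** Taylor's formula in the parameter of the curve rather than along segments,
   because only the curve is known to stay in O. *)
Lemma parabola_taylor (O : set V) f D H (x mu v : V) (M s : R) :
  open O -> C2_on O f D H -> 0 <= s ->
  (forall r : R, 0 <= r <= s -> O (parabola x mu v r)) ->
  (forall r : R, 0 <= r <= s ->
    `|quadf (H (parabola x mu v r)) ((2 * r) *: mu + v)
        + 2 * dotp (D (parabola x mu v r)) mu
      - (quadf (H x) v + 2 * dotp (D x) mu)| <= M) ->
  `|f (parabola x mu v s) - f x - s * dotp (D x) v
    - s ^+ 2 * (dotp (D x) mu + 2^-1 * quadf (H x) v)| <= M * s ^+ 2.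
Proof.
move=> oO [C1 DH cH] s0 Oc bM.
have c0 : parabola x mu v 0 = x by rewrite /parabola expr0n/= !scale0r !addr0.
have := @taylor2_bound _ (fun r => f (parabola x mu v r))
  (fun r => dotp (D (parabola x mu v r)) ((2 * r) *: mu + v))
  (fun r => quadf (H (parabola x mu v r)) ((2 * r) *: mu + v)
            + 2 * dotp (D (parabola x mu v r)) mu) M s s0.
rewrite c0 mulr0 scale0r add0r => th.
rewrite (_ : s ^+ 2 * _ = s ^+ 2 / 2 * (quadf (H x) v + 2 * dotp (D x) mu));
  last by field.
apply: th => // r rs; first exact: chain_rule_parabola (Oc _ rs).
have C1i (i : 'I_N) : C1_on O (fun y => D y i 0) (fun y => \col_j H y i j).
  split=> [y j Oy|y Oy]; first by rewrite mxE; exact: DH.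
  apply: continuous_at_ball => e e0.
  have [q q0 qP] := open_ball_continuous oO Oy (cH _ Oy) e0.
  exists q => // y' /qP[_ Hy']; apply: mx_norm_leP => [|k l]; first exact: ltW.
  rewrite !mxE; apply: le_trans Hy'.
  by have := ler_norm_entry (H y' - H y) i k; rewrite !mxE.
have di (i : 'I_N) := chain_rule_parabola oO (C1i i) (Oc _ rs).
have dl (i : 'I_N) : is_derive r 1 (fun r0 : R => (2 * r0) * mu i 0 + v i 0)
    (2 * mu i 0).
  apply: is_derive_eps => e e0; exists 1 => // h _.
  by rewrite (_ : _ - _ = 0) ?normr0 ?mulr_ge0// ?ltW//; ring.
have := is_derive_sum (fun i => is_deriveM (di i) (dl i)).
rewrite (_ : \sum_(_ < _) _ = (fun r0 => dotp (D (parabola x mu v r0))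
   ((2 * r0) *: mu + v))); last first.
  apply/funext => q; rewrite fct_sumE; apply: eq_bigr => i _.
  by rewrite !mxE.
move/is_derive_eq; apply.
rewrite /quadf /dotp mulr_sumr -big_split/=; apply: eq_bigr => i _.
set w := (2 * r) *: mu + v.
have -> : \sum_(j < N) (\col_j H (parabola x mu v r) i j) j 0 * w j 0 =
    (H (parabola x mu v r) *m w) i 0.
  by rewrite mxE; apply: eq_bigr => j _; rewrite mxE.
have -> : w i 0 = 2 * r * mu i 0 + v i 0 by rewrite !mxE.
by rewrite /GRing.scale/=; ring.
Qed.

End C2.

(** * Norms, compactness, and bounds for functions of class C^{2,g} *)

Section Norms.
Context {R : realType}.

Lemma mx_norm_le_enorm m n (M : 'M[R]_(m, n)) : `|M| <= enorm M.
Proof.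
apply: mx_norm_leP => [|i j]; first exact: sqrtr_ge0.
rewrite -sqrtr_sqr ler_sqrt; last by do 2![apply: sumr_ge0 => ? _]; rewrite sqr_ge0.
rewrite (bigD1 i)//= (bigD1 j)//= -addrA lerDl addr_ge0//.
  by apply: sumr_ge0 => k _; exact: sqr_ge0.
by do 2![apply: sumr_ge0 => ? _]; exact: sqr_ge0.
Qed.

Lemma enorm_le_mx_norm N (v : 'cV[R]_N) : enorm v <= N%:R * `|v|.
Proof.
rewrite -[leRHS]ger0_norm ?mulr_ge0// -sqrtr_sqr ler_sqrt ?sqr_ge0//.
rewrite exprMn -natrX.
have vi (i : 'I_N) : \sum_(j < 1) v i j ^+ 2 <= `|v| ^+ 2.
  rewrite big_ord1 -[leLHS]ger0_norm ?sqr_ge0// normrX.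
  by rewrite lerXn2r ?nnegrE// ler_norm_entry.
apply: le_trans (ler_sum _ (fun i _ => vi i)) _.
rewrite sumr_const card_ord -[leLHS]mulr_natl ler_wpM2r ?sqr_ge0// ler_nat.
by case: (N) => // k; rewrite expnS expn1 leq_pmulr.
Qed.

Lemma mulmx_norm_le m n p (A : 'M[R]_(m, n)) (B : 'M[R]_(n, p)) :
  `|A *m B| <= n%:R * (`|A| * `|B|).
Proof.
apply: mx_norm_leP => [|i j]; first by rewrite !mulr_ge0.
rewrite mxE; apply: le_trans (ler_norm_sum _ _ _) _.
have le1 (k : 'I_n) : `|A i k * B k j| <= `|A| * `|B|.
  by rewrite normrM ler_pM// ler_norm_entry.
apply: le_trans (ler_sum _ (fun i _ => le1 i)) _.
by rewrite sumr_const card_ord mulr_natl.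
Qed.

Lemma pdist_ge0 N (z z' : R * 'cV[R]_N) : 0 <= pdist z z'.
Proof. by rewrite addr_ge0 ?sqrtr_ge0. Qed.

Lemma pdist_gt0 N (z z' : R * 'cV[R]_N) : z <> z' -> 0 < pdist z z'.
Proof.
case: z z' => t x [t' x'] zz'; rewrite lt_def pdist_ge0 andbT.
apply/negP => /eqP; rewrite /pdist/= => /eqP.
rewrite paddr_eq0 ?sqrtr_ge0// => /andP[/eqP x0 /eqP t0]; apply: zz'.
have := mx_norm_le_enorm (x - x').
  rewrite x0 normr_le0 subr_eq0 => /eqP ->.
move/eqP: t0; rewrite sqrtr_eq0 normr_le0 subr_eq0 => /eqP ->.
by [].
Qed.

Lemma bounded_closed_compact_col N (S : set 'cV[R]_N) :
  bounded_set S -> closed S -> compact S.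
Proof.
have ctr m n : continuous (fun M : 'M[R]_(m, n) => M^T).
  move=> M; apply: continuous_at_ball => e e0; exists e => // M' MM'.
  apply: mx_norm_leP => [|i j]; first exact: ltW.
  rewrite !mxE; apply: le_trans (ltW MM').
  by have := ler_norm_entry (M' - M) j i; rewrite !mxE.
move=> [B [Br SB]] cS.
pose S' : set 'rV[R]_N := (fun M : 'rV[R]_N => M^T) @^-1` S.
have cS' : closed S' by apply: preimage_closed => // x _; exact: ctr.
have bS' : bounded_set S'.
  exists B; split => // b /SB Sb v /Sb; apply: le_trans.
  by apply: mx_norm_leP => // i j; have := ler_norm_entry v^T j i; rewrite mxE.
have -> : S = (fun M : 'rV[R]_N => M^T) @` S'.
  apply/seteqP; split=> [v Sv|_ [v Sv <-]//].
  by exists v^T; rewrite /S'/= ?trmxK.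
apply: continuous_compact; last exact: bounded_closed_compact.
by apply: continuous_subspaceT; exact: ctr.
Qed.

Lemma bounded_closure_compact N (S : set 'cV[R]_N) :
  bounded_set S -> compact (closure S).
Proof.
move=> [B [Br SB]]; apply: bounded_closed_compact_col; last exact: closed_closure.
exists B; split=> // b Bb.
have cl : closed [set y : 'cV[R]_N | `|y| <= b].
  apply: (@closed_comp _ _ _ [set r | r <= b]); last exact: closed_le.
  by move=> y _; exact: norm_continuous.
move: (closure_subset (SB _ Bb)) => /=.
by move=> sub x /sub; rewrite -((closure_id _).1 cl).
Qed.

Lemma compact_bound (U : topologicalType) (W : normedModType R) (K : set U)
    (f : U -> W) : compact K -> {within K, continuous f} ->
  exists2 B : R, 0 <= B & forall z, K z -> `|f z| <= B.
Proof.
move=> cK cf.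
have /ex_strict_bound_gt0[B B0 fB] := compact_bounded (continuous_compact cf cK).
by exists B => [|z Kz]; [exact: ltW|apply/ltW/fB; exists z].
Qed.

End Norms.

Section Hoelder.
Context {R : realType} {N : nat}.
Notation V := 'cV[R]_N.

Lemma hoelder_norm_bound (g : R) (U : set (R * V)) (w : R * V -> R) z0 z1 :
  U z0 -> U z1 -> z0 <> z1 ->
  (0 <= hoelder_norm g U w)%E /\
  ((hoelder_norm g U w < +oo)%E -> exists2 B, 0 <= B &
    forall z z', U z -> U z' -> `|w z - w z'| <= B * pdist z z' `^ g).
Proof.
move=> Uz0 Uz1 z01.
have sup0 : (0 <= supnorm U w)%E.
  apply: (@le_trans _ _ (`|w z0|)%:E); first by rewrite lee_fin.
  by apply: ereal_sup_ubound; exists z0.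
have sem0 : (0 <= hoelder_seminorm g U w)%E.
  apply: (@le_trans _ _ (`|w z0 - w z1| / pdist z0 z1 `^ g)%:E).
    by rewrite lee_fin divr_ge0// powR_ge0.
  by apply: ereal_sup_ubound; exists z0, z1.
split; first exact: adde_ge0.
move=> fin.
have {}fin : (hoelder_seminorm g U w < +oo)%E.
  by apply: le_lt_trans fin; rewrite /hoelder_norm leeDr.
exists (fine (hoelder_seminorm g U w)); first exact: fine_ge0.
move=> z z' Uz Uz'; have [->|/eqP zz'] := eqVneq z z'.
  by rewrite subrr normr0 mulr_ge0 ?fine_ge0// powR_ge0.
rewrite -ler_pdivrMr ?powR_gt0 ?pdist_gt0// -lee_fin fineK ?ge0_fin_numE//.
by apply: ereal_sup_ubound; exists z, z'.
Qed.

(** A quantitative form of the class C^{2,g}: it provides one constant for all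
   estimates and is stable under linear combinations.  Second derivatives are
   compared inside O only, where their symmetry extends the bound from the
   entries i <= j to the whole matrix. *)
Record tame (T : R) (O : set V) (g C : R) (w : jet R N) : Prop := Tame {
  tame_der : has_derivatives `[0, T] O w ;
  tame_cont : jet_continuous (closed_cylinder T O) w ;
  tame_sup : forall z, closed_cylinder T O z ->
    [/\ `|w z| <= C, `|jt w z| <= C, `|jx w z| <= C & `|jxx w z| <= C] ;
  tame_hoelder : forall z z', closed_cylinder T O z -> closed_cylinder T O z' ->
    [/\ `|w z - w z'| <= C * pdist z z' `^ g,
        `|jt w z - jt w z'| <= C * pdist z z' `^ g &
        `|jx w z - jx w z'| <= C * pdist z z' `^ g] ;
  tame_hoelder2 : forall z z', (`[0, T] `*` O) z -> (`[0, T] `*` O) z' ->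
    `|jxx w z - jxx w z'| <= C * pdist z z' `^ g }.

End Hoelder.

Section Jets.
Context {R : realType} {N : nat}.
Notation V := 'cV[R]_N.

Definition jet_lin (k : R) (w1 w2 : jet R N) : jet R N :=
  Jet (fun z => w1 z + k * w2 z) (fun z => jt w1 z + k * jt w2 z)
      (fun z => jx w1 z + k *: jx w2 z) (fun z => jxx w1 z + k *: jxx w2 z).

Definition jet_cst (c : R) : jet R N := Jet (cst c) (cst 0) (cst 0) (cst 0).

Lemma has_derivatives_lin I (O : set V) k w1 w2 :
  has_derivatives I O w1 -> has_derivatives I O w2 ->
  has_derivatives I O (jet_lin k w1 w2).
Proof.
move=> d1 d2 t x It Ox.
have [t1 x1 xx1] := d1 t x It Ox; have [t2 x2 xx2] := d2 t x It Ox.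
have dlin (f1 f2 : V -> R) (a1 a2 : R) (e : V) : is_derive x e f1 a1 ->
    is_derive x e f2 a2 -> is_derive x e (fun y => f1 y + k * f2 y) (a1 + k * a2).
  by move=> f1e f2e; exact: (is_deriveD f1e (is_deriveZ k f2e)).
split.
- rewrite (_ : (fun s => _) = fun s => (w1 (s, x) - w1 (t, x)) / (s - t)
      + k * ((w2 (s, x) - w2 (t, x)) / (s - t))); last first.
    by apply/funext => s /=; ring.
  by apply: cvgD; [exact: t1|apply: cvgM; [exact: cvg_cst|exact: t2]].
- by move=> i; rewrite /= !mxE; exact: dlin.
- move=> i j; rewrite /= !mxE.
  rewrite (_ : (fun y => _) = fun y => jx w1 (t, y) i 0 + k * jx w2 (t, y) i 0).
    exact: dlin.
  by apply/funext => y; rewrite !mxE.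
Qed.

Lemma jet_continuous_lin (U : set (R * V)) k w1 w2 :
  jet_continuous U w1 -> jet_continuous U w2 ->
  jet_continuous U (jet_lin k w1 w2).
Proof.
move=> [v1 t1 x1 xx1] [v2 t2 x2 xx2]; split=> z /=.
- by apply: cvgD; [exact: v1|apply: cvgM; [exact: cvg_cst|exact: v2]].
- by apply: cvgD; [exact: t1|apply: cvgM; [exact: cvg_cst|exact: t2]].
- by apply: cvgD; [exact: x1|apply: cvgZ; [exact: cvg_cst|exact: x2]].
- by apply: cvgD; [exact: xx1|apply: cvgZ; [exact: cvg_cst|exact: xx2]].
Qed.

Lemma has_derivatives_cst I (O : set V) c : has_derivatives I O (jet_cst c).
Proof.
move=> t x _ _; split=> /=.
- rewrite (_ : (fun s => _) = cst 0); first exact: cvg_cst.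
  by apply/funext => s; rewrite /cst/= subrr mul0r.
- by move=> i; rewrite mxE; exact: is_derive_cst.
- by move=> i j; rewrite !mxE; exact: is_derive_cst.
Qed.

Lemma jet_continuous_cst (U : set (R * V)) c : jet_continuous U (jet_cst c).
Proof. by split=> z; exact: cvg_cst. Qed.

Lemma C12_lin T (O : set V) k w1 w2 :
  C12 T O w1 -> C12 T O w2 -> C12 T O (jet_lin k w1 w2).
Proof.
move=> [d1 c1] [d2 c2].
by split; [exact: has_derivatives_lin|exact: jet_continuous_lin].
Qed.

Lemma C12_cst T (O : set V) c : C12 T O (jet_cst c).
Proof. by split; [exact: has_derivatives_cst|exact: jet_continuous_cst]. Qed.

Lemma tame_C12 T (O : set V) g C w : tame T O g C w -> C12 T O w.
Proof.
case=> d [c1 c2 c3 c4] _ _ _.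
have sub : `[0, T[ `*` O `<=` closed_cylinder T O.
  move=> [t x] [/= t0 Ox]; split; last exact: subset_closure.
  by move: t0; rewrite /= !in_itv/= => /andP[-> /ltW ->].
split; last by split; apply: (continuous_subspaceW sub).
move=> t x; rewrite /= in_itv/= => /andP[t0 tT] Ox.
have [] := d t x _ Ox; first by rewrite /= in_itv/= t0 ltW.
move=> dt dx dxx; split=> //; apply: cvg_trans dt.
apply: cvg_app; apply: within_subset.
by move=> s; rewrite /= !in_itv/= => /andP[-> /ltW ->].
Qed.

Lemma tame_lin T (O : set V) g C1 C2 k w1 w2 :
  tame T O g C1 w1 -> tame T O g C2 w2 ->
  tame T O g (C1 + `|k| * C2) (jet_lin k w1 w2).
Proof.
move=> [d1 c1 s1 h1 hh1] [d2 c2 s2 h2 hh2].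
have bnd (W : normedModType R) (a b : W) (A B : R) :
    `|a| <= A -> `|b| <= B -> `|a + k *: b| <= A + `|k| * B.
  move=> aA bB; apply: le_trans (ler_normD _ _) _.
  by rewrite lerD// normrZ ler_wpM2l.
have dif (W : normedModType R) (a a' b b' : W) (q : R) :
    `|a - a'| <= C1 * q -> `|b - b'| <= C2 * q ->
    `|a + k *: b - (a' + k *: b')| <= (C1 + `|k| * C2) * q.
  move=> aA bB; rewrite opprD addrACA -scalerBr mulrDl -mulrA.
  exact: bnd.
split.
- exact: has_derivatives_lin.
- exact: jet_continuous_lin.
- move=> z Uz; have [? ? ? ?] := s1 z Uz; have [? ? ? ?] := s2 z Uz.
  by split; [exact: (bnd R^o)|exact: (bnd R^o)|exact: bnd|exact: bnd].
- move=> z z' Uz Uz'; have [? ? ?] := h1 z z' Uz Uz'.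
  have [? ? ?] := h2 z z' Uz Uz'.
  by split; [exact: (dif R^o)|exact: (dif R^o)|exact: dif].
- move=> z z' Uz Uz'; have ? := hh1 z z' Uz Uz'; have ? := hh2 z z' Uz Uz'.
  exact: dif.
Qed.

Lemma jet_C2_on (T : R) (O : set V) w (t : R) : open O ->
  has_derivatives `[0, T] O w -> jet_continuous (closed_cylinder T O) w ->
  0 <= t <= T ->
  C2_on O (fun y => w (t, y)) (fun y => jx w (t, y)) (fun y => jxx w (t, y)).
Proof.
move=> oO d [_ _ cx cxx] tT.
have cont (W : normedModType R) (F : R * V -> W) y : O y ->
    {within closed_cylinder T O, continuous F} ->
    {for y, continuous (fun y' => F (t, y'))}.
  move=> Oy cF; apply: continuous_at_ball => e e0.
  have Qt y' : O y' -> closed_cylinder T O (t, y').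
    by move=> Oy'; split; [rewrite /= in_itv|exact: subset_closure].
  have [r r0 rP] := within_continuous_ball cF (Qt y Oy) e0.
  have /nbhs_normP[q /= q0 qP] : \forall y' \near y, O y' by exact: open_nbhs_nbhs.
  exists (Num.min r q); first by rewrite lt_min r0.
  move=> y'; rewrite lt_min => /andP[y'r y'q]; apply: rP.
    by apply/Qt/qP; rewrite /ball_/= distrC.
  by rewrite prod_normE/= subrr normr0 gt_max r0.
have tI : t \in `[0, T] by rewrite /= in_itv.
split; [split|..].
- by move=> y i Oy; have [_ + _] := d t y tI Oy; exact.
- by move=> y Oy; exact: cont.
- by move=> y i j Oy; have [_ _] := d t y tI Oy; exact.
- by move=> y Oy; exact: cont.
Qed.

(** Suprema are finite by compactness of the closed cylinder; only the Hoelder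
   quotients are read off the norm. *)
Lemma C2g_tame T (O : set V) g w : 0 < T -> open O -> O !=set0 -> bounded_set O ->
  C2g T O g w -> exists2 C, 0 <= C & tame T O g C w.
Proof.
move=> T0 oO [x0 Ox0] bO [d [cv ct cx cxx] fin].
set U := closed_cylinder T O.
have cU : compact U.
  by apply: compact_setX; [exact: segment_compact|exact: bounded_closure_compact].
have [B1 B10 b1] := compact_bound cU cv.
have [B2 B20 b2] := compact_bound cU ct.
have [B3 B30 b3] := compact_bound cU cx.
have [B4 B40 b4] := compact_bound cU cxx.
have U0 : U (0, x0) by split; [rewrite /= in_itv/= lexx ltW|exact: subset_closure].
have U1 : U (T, x0) by split; [rewrite /= in_itv/= lexx ltW|exact: subset_closure].
have U01 : (0, x0) <> (T, x0) by case=> T0E; move: T0; rewrite -T0E ltxx.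
have hb f := hoelder_norm_bound g f U0 U1 U01.
have h0 f : (0 <= hoelder_norm g U f)%E by have [] := hb f.
have hfin f := (hb f).2.
have split2 (a b : \bar R) : (0 <= a)%E -> (0 <= b)%E -> (a + b < +oo)%E ->
    (a < +oo)%E /\ (b < +oo)%E.
  by move=> a0 b0 ab; split; apply: le_lt_trans ab; rewrite ?leeDl ?leeDr.
have sumfin (I : finType) (Q : pred I) (F : I -> \bar R) i :
    (forall i, 0 <= F i)%E -> Q i -> (\sum_(i | Q i) F i < +oo)%E -> (F i < +oo)%E.
  move=> F0 Qi; apply: le_lt_trans; rewrite (bigD1 i)//= leeDl//.
  exact: sume_ge0.
move: fin; rewrite /norm2g -/U.
move=> /split2[].
- by apply: adde_ge0; [exact: adde_ge0|exact: sume_ge0].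
- by apply: sume_ge0 => i _; apply: sume_ge0.
move=> /split2[]; [exact: adde_ge0|exact: sume_ge0|].
move=> /split2[]// /hfin[C1 C10 c1] /hfin[C2 C20 c2] f3 f4.
have /choice[C3 C3P] (i : 'I_N) : exists C : R, 0 <= C /\ forall z z', U z -> U z' ->
    `|jx w z i 0 - jx w z' i 0| <= C * pdist z z' `^ g.
  have [C ? ?] := hfin _ (sumfin _ _ _ i (fun i => h0 _) isT f3).
  by exists C.
have f4i (i j : 'I_N) : (i <= j)%N -> (hoelder_norm g U (fun z => jxx w z i j) < +oo)%E.
  move=> ij.
  apply: (sumfin _ (fun j : 'I_N => (i <= j)%N)
    (fun j => hoelder_norm g U (fun z => jxx w z i j)) j (fun j => h0 _) ij).
  by apply: (sumfin _ _ _ i _ isT f4) => k; apply: sume_ge0 => l _; exact: h0.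
have /choice[C4 C4P] (ij : 'I_N * 'I_N) : exists C : R, 0 <= C /\
    ((ij.1 <= ij.2)%N -> forall z z', U z -> U z' ->
    `|jxx w z ij.1 ij.2 - jxx w z' ij.1 ij.2| <= C * pdist z z' `^ g).
  case: (leqP ij.1 ij.2) => [/f4i/hfin[C ? ?]|_]; first by exists C.
  by exists 0.
pose C := B1 + B2 + B3 + B4 + C1 + C2 + \sum_i C3 i + \sum_ij C4 ij.
have S3 : 0 <= \sum_i C3 i by apply: sumr_ge0 => i _; have [] := C3P i.
have S4 : 0 <= \sum_ij C4 ij by apply: sumr_ge0 => i _; have [] := C4P i.
have C3le i : C3 i <= C.
  have : C3 i <= \sum_i C3 i.
    by rewrite (bigD1 i)//= lerDl sumr_ge0// => k _; have [] := C3P k.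
  by rewrite /C; lra.
have C4le ij : C4 ij <= C.
  have : C4 ij <= \sum_ij C4 ij.
    by rewrite (bigD1 ij)//= lerDl sumr_ge0// => k _; have [] := C4P k.
  by rewrite /C; lra.
have C0 : 0 <= C by rewrite /C; lra.
have up (q A B : R) : A <= B * q -> 0 <= q -> B <= C -> A <= C * q.
  by move=> AB q0 BC; apply: le_trans AB _; rewrite ler_wpM2r.
exists C => //.
split=> //.
- move=> z Uz; move: (b1 z Uz) (b2 z Uz) (b3 z Uz) (b4 z Uz) => *.
  by split; rewrite /C; lra.
- move=> z z' Uz Uz'; split.
  + by apply: up (c1 _ _ Uz Uz') _ _; rewrite ?powR_ge0// /C; lra.
  + by apply: up (c2 _ _ Uz Uz') _ _; rewrite ?powR_ge0// /C; lra.
  + apply: mx_norm_leP => [|i j]; first by rewrite mulr_ge0// powR_ge0.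
    rewrite ord1 !mxE; apply: up ((C3P i).2 _ _ Uz Uz') _ _ => //.
    exact: powR_ge0.
- have sym (t : R) x i j : 0 <= t <= T -> O x -> jxx w (t, x) i j = jxx w (t, x) j i.
    by move=> tI; exact: (second_partials_symmetric _ _ oO (jet_C2_on oO d _ tI)).
  move=> [t x] [t' x'] [/= tI Ox] [/= tI' Ox'].
  apply: mx_norm_leP => [|i j]; first by rewrite mulr_ge0// powR_ge0.
  rewrite !mxE.
  wlog ij : i j / (i <= j)%N => [th|].
    have [/th//|/ltnW/th] := leqP i j.
    by rewrite (sym t)// (sym t' x').
  apply: up ((C4P (i, j)).2 ij (t, x) (t', x') _ _) _ _; rewrite ?powR_ge0//.
  + by split=> //; exact: subset_closure.
  + by split=> //; exact: subset_closure.
Qed.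

End Jets.

(** * Local expansions *)

Section Expansion.
Context {R : realType} {N : nat}.
Notation V := 'cV[R]_N.

(** Carries an expansion along a path in the open domain over to an end point
   on the boundary, where the derivatives are not available. *)
Lemma left_limit_bound (U : normedModType R) (K : set U) (w : U -> R)
    (path : R -> U) (k a b B S L : R) : 0 < S ->
  {within K, continuous w} ->
  (forall s, 0 <= s <= S -> K (path s)) ->
  (forall s, 0 <= s <= S -> `|path s - path S| <= L * (S - s)) ->
  (forall s, 0 <= s < S -> `|w (path s) - k - s * a - s ^+ 2 * b| <= B) ->
  `|w (path S) - k - S * a - S ^+ 2 * b| <= B.
Proof.
move=> S0 cw Kp Lp bB; apply/ler_addgt0Pl => /= e e0.
have e2 : 0 < e / 2 by rewrite divr_gt0.
have SS : 0 <= S <= S by rewrite lexx ltW.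
have [r r0 rP] := within_continuous_ball cw (Kp S SS) e2.
pose m := `|L| + 1; pose n := `|a| + 2 * S * `|b| + 1.
have m0 : 0 < m by rewrite ltr_wpDl.
have n0 : 0 < n by rewrite ltr_wpDl// addr_ge0// !mulr_ge0// ltW.
pose d := Num.min (S / 2) (Num.min (r / 2 / m) (e / 2 / n)).
have d0 : 0 < d by rewrite !lt_min !divr_gt0.
have dS : d <= S / 2 by rewrite ge_min lexx.
have dr : m * d <= r / 2.
  by rewrite mulrC -ler_pdivlMr// !ge_min lexx orbT.
have de : n * d <= e / 2.
  by rewrite mulrC -ler_pdivlMr// !ge_min lexx !orbT.
have sS : 0 <= S - d < S by apply/andP; split; lra.
have sS' : 0 <= S - d <= S by apply/andP; split; lra.
have close : `|path (S - d) - path S| < r.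
  apply: le_lt_trans (Lp _ sS') _; rewrite subKr.
  have : L * d <= m * d by rewrite ler_wpM2r ?(ltW d0)// /m ler_wpDr// ler_norm.
  lra.
have := rP _ (Kp _ sS') close; have := bB _ sS.
set u := w (path S); set u' := w (path (S - d)) => b1 b2.
have -> : u - k - S * a - S ^+ 2 * b =
    (u' - k - (S - d) * a - (S - d) ^+ 2 * b) - (u' - u)
    - (d * a + d * (2 * S - d) * b) by ring.
have b3 : `|d * a + d * (2 * S - d) * b| <= e / 2.
  apply: le_trans de; rewrite -mulrA -mulrDr normrM gtr0_norm// mulrC.
  apply: ler_wpM2r; first exact: ltW.
  apply: le_trans (ler_normD _ _) _; rewrite normrM.
  rewrite ger0_norm; last by lra.
  rewrite /n -addrA lerD// ler_wpDr//; apply: ler_wpM2r => //; lra.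
apply: le_trans (ler_normB _ _) _.
have := ler_normB (u' - k - (S - d) * a - (S - d) ^+ 2 * b) (u' - u).
lra.
Qed.

Lemma quadf_le (H : 'M[R]_N) (v : V) : `|quadf H v| <= N%:R ^+ 2 * (`|H| * `|v| ^+ 2).
Proof.
apply: le_trans (dotp_le _ _) _; rewrite [N%:R ^+ 2]expr2 -mulrA ler_wpM2l//.
by rewrite expr2 !mulrA ler_wpM2r// -mulrA mulmx_norm_le.
Qed.

Lemma quadfB (H H' : 'M[R]_N) (v u : V) :
  quadf H' (u + v) - quadf H v =
  quadf (H' - H) (u + v) + (dotp (H *m u) (u + v) + dotp (H *m v) u).
Proof.
rewrite /quadf mulmxBl.
rewrite dotpBl (mulmxDr H) [dotp (H *m u + H *m v) _]dotpC (dotpDr _ (H *m u)).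
by rewrite !(dotpC (u + v)) (dotpDr (H *m v)); ring.
Qed.

(** The time derivative is one-sided at the ends of [0, T], so the mean value
   theorem is applied with continuity on the closed interval only. *)
Lemma jet_time_increment (T : R) (O : set V) (w : jet R N) (t q : R) (y : V) :
  has_derivatives `[0, T] O w -> jet_continuous (closed_cylinder T O) w -> O y ->
  0 <= t -> 0 <= q -> t + q <= T ->
  exists2 xi, t <= xi <= t + q & w (t + q, y) - w (t, y) = q * jt w (xi, y).
Proof.
move=> dw [cw _ _ _] Oy t0 q0 tq.
have in_cyl s : t <= s <= t + q -> closed_cylinder T O (s, y).
  move=> /andP[ts sq]; split; last exact: subset_closure.
  by rewrite /= in_itv/= (le_trans t0)// (le_trans sq).
have tt : t <= t + q by rewrite lerDl.
have [||xi] := @MVT_segment _ (fun s => w (s, y)) (fun s => jt w (s, y)) t (t + q) tt.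
- move=> s; rewrite in_itv/= => /andP[ts sq].
  have [|+ _ _] := dw s y _ Oy.
    by rewrite /= in_itv/= (le_trans t0 (ltW ts)) (le_trans (ltW sq)).
  move=> /cvgrPdistC_le ds; apply: is_derive_eps => e e0.
  have /nbhs_normP[r /= r0 rP] := ds e e0.
  exists (Num.min r (Num.min (s - t) (t + q - s))).
    by rewrite !lt_min r0 !subr_gt0 ts.
  move=> h; rewrite !lt_min => /and3P[hr ht hq].
  have [->|h0] := eqVneq h 0.
    by rewrite addr0 subrr mul0r subr0 normr0 mulr0.
  have /= := rP (s + h) _ _ _; rewrite /ball_/= opprD addNKr normrN.
  move=> /(_ hr); rewrite [s + h]addrC addrK => key.
  rewrite -ler_pdivrMr ?normr_gt0// -normfV -normrM.
  have -> : (w (h + s, y) - w (s, y) - h * jt w (s, y)) / h =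
    (w (h + s, y) - w (s, y)) / h - jt w (s, y) by field.
  apply: key; first by rewrite -subr_eq0 addrK.
  move: ht hq; rewrite !ltr_norml => /andP[h1 h2] /andP[h3 h4].
  by rewrite /= in_itv/=; apply/andP; split; lra.
- apply/subspace_continuousP => s sI; apply/cvgrPdistC_le => e e0.
  have sI' : t <= s <= t + q by move: sI; rewrite /= in_itv.
  have [r r0 rP] := within_continuous_ball cw (in_cyl s sI') e0.
  apply/nbhs_normP; exists r => // s' ss' s'I; apply: rP.
    by apply: in_cyl; move: s'I; rewrite /= in_itv.
  by rewrite prod_normE/= subrr normr0 gt_max r0 andbT distrC.
- rewrite in_itv/= => xiI xiE; exists xi => //.
  by rewrite xiE addrAC subrr add0r mulrC.
Qed.

End Expansion.

Section JetExpansion.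
Context {R : realType} {N : nat}.
Notation V := 'cV[R]_N.

(** Both the displacement and the square root of the elapsed time are O(s), so a
   Hoelder quotient along a branch costs s^g. *)
Lemma parabola_pdist (K t xi s : R) (x mu v : V) :
  `|mu| <= K -> `|v| <= K -> 0 <= s <= 1 -> t <= xi <= t + s ^+ 2 ->
  pdist (xi, parabola x mu v s) (t, x) <= (2 * N%:R * K + 1) * s.
Proof.
move=> muK vK /andP[s0 s1] /andP[t1 t2].
have K0 : 0 <= K by exact: le_trans muK.
rewrite /pdist/= mulrDl mul1r lerD//.
  apply: le_trans (enorm_le_mx_norm _) _.
  rewrite [2 * _]mulrC -!mulrA; apply: ler_wpM2l => //.
  have -> : parabola x mu v s - x = s ^+ 2 *: mu + s *: v.
    by apply/colP => i; rewrite !mxE; ring.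
  apply: le_trans (ler_normD _ _) _; rewrite [X in X + _]normrZ [X in _ + X]normrZ.
  rewrite (ger0_norm s0) (ger0_norm (sqr_ge0 s)).
  have h1 : s * `|v| <= s * K by rewrite ler_wpM2l.
  have h2 : s ^+ 2 * `|mu| <= s * K.
    by rewrite ler_pM// ?sqr_ge0// expr2 ler_piMl.
  by rewrite mulr_natl mulr2n [K * s]mulrC lerD.
have -> : s = Num.sqrt (s ^+ 2) by rewrite sqrtr_sqr ger0_norm.
rewrite ler_sqrt ?sqr_ge0// ger0_norm; lra.
Qed.

Lemma quadf_parabola_le (H H' : 'M[R]_N) (mu v : V) (C K q s r : R) :
  `|H| <= C -> `|H' - H| <= q -> `|mu| <= K -> `|v| <= K -> 0 <= r <= s ->
  s <= 1 ->
  `|quadf H' ((2 * r) *: mu + v) - quadf H v| <=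
  N%:R ^+ 2 * (q * (3 * K) ^+ 2 + 8 * C * K ^+ 2 * s).
Proof.
move=> HC HH muK vK /andP[r0 rs] s1; rewrite quadfB; set u := _ *: mu.
have K0 : 0 <= K by exact: le_trans muK.
have C0 : 0 <= C by exact: le_trans HC.
have s0 : 0 <= s by exact: le_trans rs.
have uK : `|u| <= 2 * s * K.
  by rewrite normrZ normrM ger0_norm// ger0_norm// ler_pM ?mulr_ge0// ler_wpM2l.
have uvK : `|u + v| <= 3 * K.
  apply: le_trans (ler_normD _ _) _.
  have : 2 * s * K <= 2 * K by rewrite ler_wpM2r// mulr_natl mulr2n; lra.
  lra.
have bil (X : 'M[R]_N) (a b : V) (A B D : R) : `|X| <= D -> `|a| <= A -> `|b| <= B ->
    `|dotp (X *m a) b| <= N%:R ^+ 2 * (D * A * B).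
  move=> XD aA bB; apply: le_trans (dotp_le _ _) _.
  rewrite [N%:R ^+ 2]expr2 -[leRHS]mulrA ler_wpM2l// mulrA.
  apply: ler_pM => //; apply: le_trans (mulmx_norm_le _ _) _.
  by rewrite ler_wpM2l// ler_pM.
have h1 := bil _ _ _ _ _ _ HH uvK uvK.
have h2 := bil _ _ _ _ _ _ HC uK uvK.
have h3 := bil _ _ _ _ _ _ HC vK uK.
rewrite /quadf; apply: le_trans (ler_normD _ _) _.
have -> : N%:R ^+ 2 * (q * (3 * K) ^+ 2 + 8 * C * K ^+ 2 * s) =
  N%:R ^+ 2 * (q * (3 * K) * (3 * K)) + (N%:R ^+ 2 * (C * (2 * s * K) * (3 * K))
   + N%:R ^+ 2 * (C * K * (2 * s * K))) by ring.
by rewrite lerD// (le_trans (ler_normD _ _))// lerD.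
Qed.

Variables (T : R) (O : set V) (g C K : R).
Hypotheses (oO : open O) (g01 : 0 < g <= 1) (C0 : 0 <= C) (K0 : 0 <= K).

Let L : R := 2 * N%:R * K + 1.
Let Q : R := C * L `^ g.
Let M : R := N%:R ^+ 2 * (Q * (3 * K) ^+ 2 + 8 * C * K ^+ 2) + 2 * N%:R * Q * K.

Lemma constant_ge0 : 0 <= Q /\ 0 <= M.
Proof.
have Q0 : 0 <= Q by rewrite mulr_ge0// powR_ge0.
have ? : 0 <= (3 * K) ^+ 2 by exact: sqr_ge0.
split=> //.
have CK : 0 <= 8 * C * K ^+ 2 by rewrite mulr_ge0 ?exprn_ge0// mulr_ge0.
have QK : 0 <= Q * (3 * K) ^+ 2 by exact: mulr_ge0.
have NQ : 0 <= 2 * N%:R * Q * K by do 3![apply: mulr_ge0 => //].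
by apply: addr_ge0 => //; apply: mulr_ge0; [exact: exprn_ge0|exact: addr_ge0].
Qed.

Lemma hoelder_parabola (xi t s : R) (x mu v : V) :
  `|mu| <= K -> `|v| <= K -> 0 <= s <= 1 -> t <= xi <= t + s ^+ 2 ->
  C * pdist (xi, parabola x mu v s) (t, x) `^ g <= Q * s `^ g.
Proof.
move=> muK vK s01 xit; rewrite -mulrA ler_wpM2l//.
case/andP: (g01) => g0 g1; case/andP: (s01) => s0 s1.
have L0 : 0 <= L by rewrite addr_ge0// !mulr_ge0.
rewrite -powRM//; apply: ge0_ler_powR; first exact: ltW.
- by rewrite nnegrE pdist_ge0.
- by rewrite nnegrE mulr_ge0.
- exact: parabola_pdist.
Qed.

Lemma le_powR01 (s : R) : 0 <= s <= 1 -> s <= s `^ g.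
Proof.
case/andP: g01 => g0 g1 /andP[+ s1]; rewrite le_eqVlt => /orP[/eqP<-|s0].
  by rewrite powR_ge0.
by apply: ger1_powR => //; rewrite s0.
Qed.

(** The time increment is taken at the end point y of the branch and the space
   increment at the initial time.  In the other order the gradient would be
   needed at the later time; it is only g/2-Hoelder in time, and this would
   leave an error s^(1 + g). *)
Lemma jet_parabola_expansion_open w t x mu v s :
  tame T O g C w -> 0 <= t -> 0 <= s <= 1 -> t + s ^+ 2 <= T ->
  `|mu| <= K -> `|v| <= K ->
  (forall r, 0 <= r <= s -> O (parabola x mu v r)) ->
  `|w (t + s ^+ 2, parabola x mu v s) - w (t, x) - s * dotp (jx w (t, x)) v
    - s ^+ 2 * (jt w (t, x) + (dotp (jx w (t, x)) mu
                + 2^-1 * quadf (jxx w (t, x)) v))| <= (Q + M) * (s ^+ 2 * s `^ g).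
Proof.
move=> [dw cw sw hw hhw] t0 s01 tsT muK vK Oc; case/andP: (s01) => s0 s1.
case/andP: (g01) => g0 g1.
have [Q0 _] := constant_ge0.
have s20 : 0 <= s ^+ 2 by exact: sqr_ge0.
have c0 : parabola x mu v 0 = x by rewrite /parabola expr0n/= !scale0r !addr0.
have Ox : O x by rewrite -c0; apply: Oc; rewrite lexx.
have Os : O (parabola x mu v s) by apply: Oc; rewrite lexx s0.
have tT : 0 <= t <= T by rewrite t0 (le_trans _ tsT)// lerDl.
have tI (xi : R) y : 0 <= xi <= T -> O y -> (`[0, T] `*` O) (xi, y).
  by move=> xiI Oy; split; rewrite //= in_itv.
have cyl (xi : R) y : 0 <= xi <= T -> O y -> closed_cylinder T O (xi, y).
  by move=> xiI Oy; split; [rewrite /= in_itv|exact: subset_closure].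
set y := parabola x mu v s.
have [xi xit wt] := jet_time_increment dw cw Os t0 s20 tsT.
have xiT : 0 <= xi <= T.
  by case/andP: xit => x1 x2; rewrite (le_trans t0 x1) (le_trans x2 tsT).
have part1 : `|w (t + s ^+ 2, y) - w (t, y) - s ^+ 2 * jt w (t, x)|
    <= Q * (s ^+ 2 * s `^ g).
  rewrite wt -mulrBr normrM ger0_norm// mulrCA ler_wpM2l//.
  have [_ h _] := hw _ _ (cyl xi y xiT Os) (cyl t x tT Ox).
  by apply: le_trans h _; exact: hoelder_parabola.
have part2 : `|w (t, y) - w (t, x) - s * dotp (jx w (t, x)) v
    - s ^+ 2 * (dotp (jx w (t, x)) mu + 2^-1 * quadf (jxx w (t, x)) v)|
    <= M * s `^ g * s ^+ 2.
  have C2w := jet_C2_on oO dw cw tT.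
  apply: (parabola_taylor oO C2w s0 Oc) => r /andP[r0 rs].
  have r01 : 0 <= r <= 1 by rewrite r0 (le_trans rs).
  have Or : O (parabola x mu v r) by apply: Oc; rewrite r0.
  have tt : t <= t <= t + r ^+ 2 by rewrite lexx lerDl sqr_ge0.
  have rsg : r `^ g <= s `^ g.
    by apply: ge0_ler_powR; rewrite ?nnegrE// ltW.
  have [_ _ dx] := hw _ _ (cyl t _ tT Or) (cyl t x tT Ox).
  have dxx := hhw _ _ (tI t _ tT Or) (tI t x tT Ox).
  have hp : C * pdist (t, parabola x mu v r) (t, x) `^ g <= Q * s `^ g.
    by apply: le_trans (hoelder_parabola x muK vK r01 tt) _; rewrite ler_wpM2l.
  have {}dx := le_trans dx hp; have {}dxx := le_trans dxx hp.
  have [_ _ _ wxx] := sw _ (cyl t x tT Ox).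
  have r_s : 0 <= r <= s by rewrite r0.
  have key1 := quadf_parabola_le wxx dxx muK vK r_s s1.
  have key2 : `|2 * dotp (jx w (t, parabola x mu v r)) mu
      - 2 * dotp (jx w (t, x)) mu| <= 2 * N%:R * Q * K * s `^ g.
    have -> : 2 * N%:R * Q * K * s `^ g = 2 * (N%:R * (Q * s `^ g * K)) by ring.
    rewrite -mulrBr normrM ger0_norm//; apply: ler_wpM2l => //.
    rewrite -dotpBl; apply: le_trans (dotp_le _ _) _; apply: ler_wpM2l => //.
    exact: ler_pM.
  have sg := le_powR01 s01.
  have key3 : N%:R ^+ 2 * (Q * s `^ g * (3 * K) ^+ 2 + 8 * C * K ^+ 2 * s) <=
      N%:R ^+ 2 * (Q * (3 * K) ^+ 2 + 8 * C * K ^+ 2) * s `^ g.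
    have -> : N%:R ^+ 2 * (Q * (3 * K) ^+ 2 + 8 * C * K ^+ 2) * s `^ g =
      N%:R ^+ 2 * (Q * s `^ g * (3 * K) ^+ 2 + 8 * C * K ^+ 2 * s `^ g) by ring.
    apply: ler_wpM2l; first exact: exprn_ge0.
    rewrite lerD2l; apply: ler_wpM2l => //.
    by apply: mulr_ge0; [exact: mulr_ge0|exact: exprn_ge0].
  rewrite opprD addrACA; apply: le_trans (ler_normD _ _) _.
  rewrite /M [leRHS]mulrDl; apply: lerD => //.
  exact: le_trans key1 key3.
set a := dotp _ v in part2 *; set b := dotp _ mu + _ in part2 *.
have -> : w (t + s ^+ 2, y) - w (t, x) - s * a - s ^+ 2 * (jt w (t, x) + b) =
  (w (t + s ^+ 2, y) - w (t, y) - s ^+ 2 * jt w (t, x))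
  + (w (t, y) - w (t, x) - s * a - s ^+ 2 * b) by ring.
apply: le_trans (ler_normD _ _) _; rewrite [leRHS]mulrDl; apply: lerD => //.
by have -> : M * (s ^+ 2 * s `^ g) = M * s `^ g * s ^+ 2 by ring.
Qed.

Lemma jet_parabola_expansion w t x mu v s :
  tame T O g C w -> 0 <= t -> 0 < s <= 1 -> t + s ^+ 2 <= T ->
  `|mu| <= K -> `|v| <= K ->
  (forall r, 0 <= r < s -> O (parabola x mu v r)) ->
  closure O (parabola x mu v s) ->
  `|w (t + s ^+ 2, parabola x mu v s) - w (t, x) - s * dotp (jx w (t, x)) v
    - s ^+ 2 * (jt w (t, x) + (dotp (jx w (t, x)) mu
                + 2^-1 * quadf (jxx w (t, x)) v))| <= (Q + M) * (s ^+ 2 * s `^ g).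
Proof.
move=> tw t0 /andP[s0 s1] tsT muK vK Oc cOs; case: (tw) => _ [cw _ _ _] _ _ _.
have QM0 : 0 <= Q + M by have [? ?] := constant_ge0; exact: addr_ge0.
case/andP: (g01) => g0 _.
set a := dotp _ v; set b := jt w _ + _.
apply: (@left_limit_bound _ _ (closed_cylinder T O) (jval w)
  (fun r => (t + r ^+ 2, parabola x mu v r)) (w (t, x)) a b _ s (2 + 3 * K)).
- exact: s0.
- exact: cw.
- move=> r /andP[r0 rs]; split=> /=.
    rewrite in_itv/= addr_ge0 ?sqr_ge0//= (le_trans _ tsT)// lerD2l.
    by rewrite lerXn2r// nnegrE// ltW.
  by move: rs; rewrite le_eqVlt => /orP[/eqP->//|rs]; apply/subset_closure/Oc/andP.
- move=> r /andP[r0 rs]; rewrite prod_normE/= ge_max; apply/andP; split.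
    have -> : t + r ^+ 2 - (t + s ^+ 2) = - ((s - r) * (s + r)) by ring.
    have sr0 : 0 <= s - r by rewrite subr_ge0.
    have sr1 : 0 <= s + r by lra.
    rewrite normrN normrM ger0_norm// ger0_norm// mulrC; apply: ler_wpM2r => //.
    have := K0; lra.
  have -> : parabola x mu v r - parabola x mu v s =
      ((r - s) * (r + s)) *: mu + (r - s) *: v.
    by apply/colP => i; rewrite !mxE; ring.
  apply: le_trans (ler_normD _ _) _.
  rewrite [X in X + _]normrZ [X in _ + X]normrZ normrM distrC.
  have sr0 : 0 <= s - r by rewrite subr_ge0.
  have sr1 : 0 <= r + s by lra.
  rewrite (ger0_norm sr0) (ger0_norm sr1).
  have h1 : (s - r) * (r + s) * `|mu| <= (s - r) * 2 * K.
    apply: ler_pM => //; first exact: mulr_ge0.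
    by apply: ler_wpM2l => //; lra.
  have h2 : (s - r) * `|v| <= (s - r) * K by exact: ler_wpM2l.
  lra.
- move=> r /andP[r0 rs].
  have r2s2 : r ^+ 2 <= s ^+ 2 by rewrite lerXn2r// ?nnegrE// ltW.
  apply: le_trans (jet_parabola_expansion_open tw t0 _ _ muK vK _) _.
  + by rewrite r0 (le_trans (ltW rs)).
  + by apply: le_trans tsT; rewrite lerD2l.
  + by move=> q /andP[q0 qr]; apply: Oc; rewrite q0 (le_lt_trans qr).
  + rewrite ler_wpM2l// ler_pM ?sqr_ge0 ?powR_ge0//.
    by apply: ge0_ler_powR; rewrite ?nnegrE// ltW.
Qed.

Lemma jet_branch_bounds : exists2 E, 0 <= E &
  forall w t x mu v s, tame T O g C w -> 0 <= t -> 0 < s <= 1 -> t + s ^+ 2 <= T ->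
  `|mu| <= K -> `|v| <= K ->
  (forall r, 0 <= r < s -> O (parabola x mu v r)) ->
  closure O (parabola x mu v s) ->
  let W := w (t + s ^+ 2, parabola x mu v s) in
  `|W - w (t, x)| <= E * s `^ g /\
  `|W - w (t, x) - s * dotp (jx w (t, x)) v
    - s ^+ 2 * (jt w (t, x) + (dotp (jx w (t, x)) mu
                + 2^-1 * quadf (jxx w (t, x)) v))| <= E * (s ^+ 2 * s `^ g).
Proof.
exists (Q + M); first by have [? ?] := constant_ge0; exact: addr_ge0.
move=> w t x mu v s tw t0 s01 tsT muK vK Oc cOs W; split; last first.
  exact: jet_parabola_expansion.
case/andP: (s01) => s0 s1; have s20 : 0 <= s ^+ 2 by exact: sqr_ge0.
have Ox : O x.
  by have := Oc 0; rewrite /parabola expr0n/= !scale0r !addr0 lexx s0; exact.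
have [_ _ _ hw _] := tw.
have [||h _ _] := hw (t + s ^+ 2, parabola x mu v s) (t, x).
- by split; rewrite //= in_itv/= tsT addr_ge0.
- split; last exact: subset_closure.
  by rewrite /= in_itv/= t0 (le_trans _ tsT)// lerDl.
apply: le_trans h _; apply: (@le_trans _ _ (Q * s `^ g)).
  by apply: hoelder_parabola => //; rewrite ?(ltW s0)// lexx lerDl s20.
rewrite ler_wpM2r ?powR_ge0// lerDl.
by have [] := constant_ge0.
Qed.

End JetExpansion.

(** * Interpolation *)

Section Interpolation.
Context {R : realType} {N : nat}.
Notation V := 'cV[R]_N.

Lemma dotp_sumr n (u : V) (F : 'I_n -> V) : dotp u (\sum_l F l) = \sum_l dotp u (F l).
Proof.
apply: (big_morph (dotp u)) => [a b|]; first exact: dotpDr.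
by rewrite /dotp big1// => i _; rewrite mxE mulr0.
Qed.

Lemma segment_expansion (T g C : R) (O : set V) w t x y :
  open O -> tame T O g C w -> 0 <= t <= T -> closure O y ->
  (forall s, 0 <= s < 1 -> O ((1 - s) *: x + s *: y)) ->
  `|w (t, y) - w (t, x) - dotp (jx w (t, x)) (y - x)|
    <= 3 * N%:R ^+ 2 * C * `|y - x| ^+ 2.
Proof.
move=> oO tw tT cOy Oseg; set v := y - x.
case: (tw) => dw cw sw _ _; case: (cw) => cw0 _ _ _.
have segE (s : R) : parabola x 0 v s = (1 - s) *: x + s *: y.
  by apply/colP => i; rewrite !mxE; ring.
have Oc (s : R) : 0 <= s < 1 -> O (parabola x 0 v s) by rewrite segE; exact: Oseg.
have Ox : O x by have := Oc 0; rewrite /parabola !scaler0 scale0r !addr0 lexx ltr01; exact.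
have cyl (z : V) : closure O z -> closed_cylinder T O (t, z).
  by move=> Oz; split; rewrite //= in_itv.
have c1 : parabola x 0 v 1 = y by rewrite segE subrr scale0r add0r scale1r.
have Hb (z : V) : O z -> `|jxx w (t, z)| <= C.
  by move=> /subset_closure/cyl/sw[].
have C0 : 0 <= C by exact: le_trans (normr_ge0 _) (Hb x Ox).
have Qb (z : V) : O z -> `|quadf (jxx w (t, z)) v| <= N%:R ^+ 2 * C * `|v| ^+ 2.
  move=> /Hb Hz; apply: le_trans (quadf_le _ _) _.
  rewrite -mulrA ler_wpM2l ?exprn_ge0// ler_wpM2r// exprn_ge0//.
have dotp0 (u : V) : dotp u 0 = 0 by rewrite /dotp big1// => i _; rewrite mxE mulr0.
set B := N%:R ^+ 2 * C * `|v| ^+ 2 in Qb.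
have B0 : 0 <= B by exact: le_trans (normr_ge0 _) (Qb x Ox).
have lim := @left_limit_bound _ _ (closed_cylinder T O) (jval w)
  (fun s => (t, parabola x 0 v s)) (w (t, x)) (dotp (jx w (t, x)) v)
  (2^-1 * quadf (jxx w (t, x)) v) (2 * B) 1 `|v|.
have key : `|w (t, y) - w (t, x) - 1 * dotp (jx w (t, x)) v
    - 1 ^+ 2 * (2^-1 * quadf (jxx w (t, x)) v)| <= 2 * B.
  rewrite -c1; apply: lim => //.
  - move=> s /andP[s0 s1]; apply: cyl.
    move: s1; rewrite le_eqVlt => /orP[/eqP->|s1]; first by rewrite c1.
    by apply/subset_closure/Oc; rewrite s0.
  - move=> s /andP[s0 s1]; rewrite prod_normE/= subrr normr0 ge_max.
    rewrite mulr_ge0 ?subr_ge0//=.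
    have -> : parabola x 0 v s - parabola x 0 v 1 = (s - 1) *: v.
      by apply/colP => i; rewrite !mxE; ring.
    by rewrite normrZ distrC ger0_norm ?subr_ge0// mulrC.
  - move=> s /andP[s0 s1]; have s1' := ltW s1.
    have C2w := jet_C2_on oO dw cw tT.
    have := @parabola_taylor _ _ O _ _ _ x 0 v (2 * B) s oO C2w s0.
    rewrite dotp0 add0r => th; apply: le_trans (th _ _) _.
    + by move=> r /andP[r0 rs]; apply: Oc; rewrite r0 (le_lt_trans rs).
    + move=> r /andP[r0 rs]; rewrite !dotp0 mulr0 !addr0 scaler0 add0r.
      apply: le_trans (ler_normB _ _) _; rewrite mulr_natl mulr2n lerD ?Qb//.
      by apply: Oc; rewrite r0 (le_lt_trans rs).
    + by rewrite ler_piMr ?mulr_ge0// exprn_ile1.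
have := Qb x Ox; move: key; rewrite expr1n !mul1r.
set q := quadf _ _; set d := dotp _ _ => h1 h2.
have -> : w (t, y) - w (t, x) - d = (w (t, y) - w (t, x) - d - 2^-1 * q) + 2^-1 * q.
  by ring.
apply: le_trans (ler_normD _ _) _; rewrite normrM ger0_norm//.
have -> : 3 * N%:R ^+ 2 * C * `|v| ^+ 2 = 3 * B by rewrite /B; ring.
lra.
Qed.

(** Affine functions are reproduced up to the displacement of the base point,
   so only this displacement and the terms of second order contribute. *)
Lemma convex_combination_error (T g C d e : R) (O : set V) w t x n
    (lam : 'I_n -> R) (pts : 'I_n -> V) :
  open O -> tame T O g C w -> 0 <= t <= T -> O x ->
  (forall l, 0 <= lam l) -> \sum_l lam l = 1 ->
  `|\sum_l lam l *: pts l - x| <= e ->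
  (forall l, 0 < lam l ->
    [/\ `|pts l - x| <= d, closure O (pts l) &
        forall s, 0 <= s < 1 -> O ((1 - s) *: x + s *: pts l)]) ->
  `|\sum_l lam l * w (t, pts l) - w (t, x)|
    <= N%:R * C * e + 3 * N%:R ^+ 2 * C * d ^+ 2.
Proof.
move=> oO tw tT Ox lam0 lam1 le_e seg; case: (tw) => _ _ sw _ _.
have cylx : closed_cylinder T O (t, x).
  by split; [rewrite /= in_itv|exact: subset_closure].
have [_ _ jxC jxxC] := sw _ cylx.
have C0 : 0 <= C by exact: le_trans (normr_ge0 _) jxC.
set B := 3 * N%:R ^+ 2 * C * d ^+ 2.
pose D := jx w (t, x).
have -> : \sum_l lam l * w (t, pts l) - w (t, x) =
    dotp D (\sum_l lam l *: pts l - x) +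
    \sum_l lam l * (w (t, pts l) - w (t, x) - dotp D (pts l - x)).
  have -> : \sum_l lam l *: pts l - x = \sum_l lam l *: (pts l - x).
    under [in RHS]eq_bigr do rewrite scalerBr.
    by rewrite sumrB -scaler_suml lam1 scale1r.
  rewrite dotp_sumr -big_split/= -[X in _ - X]mul1r -lam1 mulr_suml -sumrB.
  by apply: eq_bigr => l _; rewrite dotpZr; ring.
apply: le_trans (ler_normD _ _) _; apply: lerD.
  by apply: le_trans (dotp_le _ _) _; rewrite -mulrA ler_wpM2l// ler_pM.
apply: le_trans (ler_norm_sum _ _ _) _.
rewrite -[B]mul1r -lam1 mulr_suml; apply: ler_sum => l _.
rewrite normrM (ger0_norm (lam0 l)).
have := lam0 l; rewrite le_eqVlt => /orP[/eqP<-|l0]; first by rewrite !mul0r.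
have [dl cl sl] := seg l l0.
rewrite ler_wpM2l//; apply: le_trans (segment_expansion oO tw tT cl sl) _.
have d0 : 0 <= d by exact: le_trans dl.
apply: ler_wpM2l; last by rewrite lerXn2r ?nnegrE.
by apply: mulr_ge0 => //; apply: mulr_ge0 => //; exact: exprn_ge0.
Qed.

Lemma hat_partition (m : mesh R N) (y : V) :
  triangulation m -> nodal_basis m -> closure (domh m) y ->
  [/\ forall k, 0 <= hat m k y, \sum_k hat m k y = 1 &
      \sum_k hat m k y *: vtx m k = y].
Proof.
move=> [_ _ _ _ [_ ->]] nb [E Em [l bl ->]].
have hatE k : hat m k (\sum_k l k *: vtx m k) = l k.
  have [nk aff] := nb k; rewrite (aff _ _ Em bl) (bigD1 k)//= nk eqxx mulr1.
  rewrite big1 ?addr0// => j jk; rewrite nk.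
  by rewrite [k == j]eq_sym (negbTE jk) mulr0.
case: bl => l0 l1 _; split.
- by move=> k; rewrite hatE.
- by rewrite -[RHS]l1; apply: eq_bigr => k _; rewrite hatE.
- by apply: eq_bigr => k _; rewrite hatE.
Qed.

End Interpolation.

(** * First exit times *)

Section FirstExit.
Context {R : realType} {U : topologicalType}.

(** The exit time is attained because the complement of O is closed, and is
   positive because O is open. *)
Lemma first_exit (O : set U) (c : R -> U) (D : R) :
  (forall W q, open W -> 0 <= q -> W (c q) ->
     exists2 r : R, 0 < r & forall q', 0 <= q' -> `|q' - q| < r -> W (c q')) ->
  open O -> O (c 0) ->
  let E := [set q | 0 < q <= D /\ ~ O (c q)] in
  E !=set0 ->
  [/\ 0 < inf E <= D, forall q, 0 <= q < inf E -> O (c q),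
      ~ O (c (inf E)) & closure O (c (inf E))].
Proof.
move=> cc oO O0 E E0.
have lbE : has_lbound E by exists 0 => q [/andP[/ltW]].
have infE : has_inf E by [].
have inf_gt0 : 0 < inf E.
  have [r r0 rP] := cc O 0 oO (lexx 0) O0.
  apply: lt_le_trans r0 _; apply: lb_le_inf => // q [/andP[q0 _] Oq].
  rewrite leNgt; apply/negP => qr; apply: Oq; apply: rP; first exact: ltW.
  by rewrite subr0 gtr0_norm.
have inside q : 0 <= q < inf E -> O (c q).
  move=> /andP[q0 qE]; move: q0; rewrite le_eqVlt => /orP[/eqP<-//|q0].
  apply: contrapT => Oq; have [e eE] := E0.
  have : inf E <= q.
    apply: (ge_inf lbE); split=> //; rewrite q0/=.
    by apply: le_trans (ltW qE) (le_trans (ge_inf lbE eE) _); case: eE => /andP[].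
  by rewrite leNgt qE.
have inf_le : inf E <= D.
  have [e eE] := E0; apply: le_trans (ge_inf lbE eE) _.
  by case: eE => /andP[].
split=> //; first by rewrite inf_gt0.
- move=> Oinf; have [r r0 rP] := cc O _ oO (ltW inf_gt0) Oinf.
  have : inf E + r <= inf E.
    apply: lb_le_inf => // q qE; have [/andP[q0 _] Oq] := qE.
    rewrite leNgt; apply/negP => qr; apply: Oq; apply: rP; first exact: ltW.
    by rewrite ger0_norm ?subr_ge0 ?(ge_inf lbE)// ltrBlDl.
  by rewrite gerDl leNgt r0.
- apply: contrapT => ncl.
  have oc : open (~` closure O) by apply: closed_openC; exact: closed_closure.
  have [r r0 rP] := cc _ _ oc (ltW inf_gt0) ncl.
  pose q := inf E - Num.min (inf E) r / 2.
  have m0 : 0 < Num.min (inf E) r by rewrite lt_min inf_gt0.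
  have mE : Num.min (inf E) r <= inf E by rewrite ge_min lexx.
  have mr : Num.min (inf E) r <= r by rewrite ge_min lexx orbT.
  have q0 : 0 <= q by rewrite /q; lra.
  have qE : q < inf E by rewrite /q; lra.
  apply: (rP q q0).
    by rewrite /q addrAC subrr add0r normrN gtr0_norm; lra.
  by apply: subset_closure; apply: inside; rewrite q0.
Qed.

End FirstExit.

Section Paths.
Context {R : realType} {N : nat}.
Notation V := 'cV[R]_N.

Lemma parabola_open (W : set V) (x mu v : V) (s0 : R) :
  open W -> W (parabola x mu v s0) ->
  exists2 d : R, 0 < d & forall s, `|s - s0| < d -> W (parabola x mu v s).
Proof.
move=> oW Ws0; have /nbhs_normP[r /= r0 rP] := open_nbhs_nbhs (conj oW Ws0).
pose L := (2 * `|s0| + 1) * `|mu| + `|v| + 1.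
have L0 : 0 < L.
  by rewrite ltr_wpDl// addr_ge0// mulr_ge0// addr_ge0// mulr_ge0.
exists (Num.min 1 (r / L)); first by rewrite lt_min ltr01 divr_gt0.
move=> s; rewrite lt_min => /andP[s1 sr]; apply: rP; rewrite /ball_/=.
have -> : parabola x mu v s0 - parabola x mu v s =
    - (s - s0) *: ((2 * s0 + (s - s0)) *: mu + v).
  by apply/colP => i; rewrite !mxE; ring.
rewrite normrZ normrN; apply: (@le_lt_trans _ _ (`|s - s0| * L)).
  rewrite ler_wpM2l// (le_trans (ler_normD _ _))// normrZ -[leLHS]addr0 lerD//.
  rewrite lerD// ler_wpM2r// (le_trans (ler_normD _ _))// normrM ger0_norm//.
  by rewrite lerD// ltW.
by rewrite -ltr_pdivlMr.
Qed.

Lemma parabola_sqrt_open (W : set V) (x mu v : V) (q : R) :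
  open W -> W (parabola x mu v (Num.sqrt q)) ->
  exists2 r : R, 0 < r &
    forall q', 0 <= q' -> `|q' - q| < r -> W (parabola x mu v (Num.sqrt q')).
Proof.
move=> oW /(parabola_open oW)[d d0 dP].
have /cvgrPdistC_lt/(_ d d0)/nbhs_normP[r /= r0 rP] := @sqrt_continuous R q.
by exists r => // q' _ qr; apply: dP; apply: rP; rewrite /ball_/= distrC.
Qed.

(** A ray from a point of O has to leave this bounded set. *)
Lemma bdry_nonempty (O : set V) :
  (0 < N)%N -> open O -> O !=set0 -> bounded_set O -> bdry O !=set0.
Proof.
move=> N0 oO [x Ox] [B [_ OB]]; have {}OB := OB (`|B| + 1).
have {}OB y : O y -> `|y| <= `|B| + 1.
  by apply: OB; rewrite ltr_pwDr// ler_norm.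
pose v : V := delta_mx (Ordinal N0) 0.
pose D := `|B| + 1 + `|x| + 1.
have D0 : 0 < D by rewrite ltr_wpDl// !addr_ge0.
have far : ~ O (parabola x 0 v D).
  move=> /OB; apply/negP; rewrite -ltNge.
  apply: lt_le_trans (ler_norm_entry _ (Ordinal N0) 0).
  rewrite !mxE !eqxx mulr0 addr0 mulr1.
  have := ler_norm_entry x (Ordinal N0) 0; rewrite ler_norml => /andP[h _].
  apply: lt_le_trans (ler_norm _); rewrite /D; lra.
have [||||[/andP[d0 _] _ nO cO]] := @first_exit _ _ O (parabola x 0 v) D.
- by move=> W q oW _ /(parabola_open oW)[r r0 rP]; exists r => // q' _; exact: rP.
- by [].
- by rewrite /parabola expr0n/= !scale0r !addr0.
- by exists D; rewrite /= D0 lexx.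
- by exists (parabola x 0 v (inf [set q | 0 < q <= D /\ ~ O (parabola x 0 v q)]));
    split=> // /interior_subset.
Qed.

End Paths.

(** * One row of the scheme *)

(** The second moments of the cubature turn the quadratic forms into the trace
   of the generator. *)
Lemma cubature_quadf (R : realType) N p (c : cubature R p) (S : 'M[R]_(N, p)) (H : 'M[R]_N) :
  cubature_ok c ->
  \sum_j wt c j * quadf H (S *m eta c j) = \tr (S *m S^T *m H).
Proof.
move=> cub; have quadf_tr (u : 'cV[R]_N) : quadf H u = \tr (H *m (u *m u^T)).
  rewrite mulmxA mxtrace_mulC trace_mx11 mxE.
  by apply: eq_bigr => r _; rewrite [u^T _ _]mxE mulrC.
have [_ _ _ _ w2] := cub.
have -> : S *m S^T = \sum_j wt c j *: ((S *m eta c j) *m (S *m eta c j)^T).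
  rewrite -[X in X *m _]mulmx1 -w2 mulmx_sumr mulmx_suml; apply: eq_bigr => j _.
  by rewrite -scalemxAr -scalemxAl trmx_mul !mulmxA.
rewrite mxtrace_mulC mulmx_sumr raddf_sum/=; apply: eq_bigr => j _.
by rewrite -scalemxAr mxtraceZ quadf_tr.
Qed.

Section Row.
Context {R : realType} {N p : nat} {A : metricType R}.
Variables (P : hjb_data R N p A) (c : cubature R p) (m : mesh R N) (Nt : nat).
Variables (n : nat) (i : 'I_(nv m)) (a : A).
Hypotheses (oO : open (dom P)) (Oi : dom P (vtx m i)) (dt0 : 0 < dt P Nt).
Hypothesis cub : cubature_ok c.
Implicit Types (j : 'I_(cM c)) (b : bool).
Notation V := 'cV[R]_N.

Let x : V := vtx m i.
Let z : R * V := (tn P Nt n, x).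
Let drift : V := mu P z a.
Let noise (j : 'I_(cM c)) : V := sigma P z a *m eta c j.
Let d (j : 'I_(cM c)) (b : bool) : R := exit_time P Nt n i a j b.
Let s (j : 'I_(cM c)) (b : bool) : R := sroot P Nt n i a j b.

Lemma branch_parabola (j : 'I_(cM c)) b (q : R) : 0 <= q ->
  branch P Nt n i a j b q = parabola x drift ((-1) ^+ b *: noise j) (Num.sqrt q).
Proof. by move=> q0; rewrite /branch /parabola sqr_sqrtr// scalerA mulrC. Qed.

Lemma exit_timeP j b :
  [/\ 0 < d j b <= dt P Nt,
      forall q, 0 <= q < d j b -> dom P (branch P Nt n i a j b q),
      closure (dom P) (branch P Nt n i a j b (d j b)) &
      if stopped P Nt n i a j b then ~ dom P (branch P Nt n i a j b (d j b))
      else d j b = dt P Nt /\ dom P (branch P Nt n i a j b (dt P Nt))].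
Proof.
have b0 : branch P Nt n i a j b 0 = x.
  by rewrite branch_parabola// sqrtr0 /parabola expr0n/= !scale0r !addr0.
rewrite /d /exit_time; case: ifPn => [/asboolP ne|/asboolP ne].
  have [||||dd ins nout cl] := @first_exit _ _ (dom P) (branch P Nt n i a j b) (dt P Nt).
  - move=> W q oW q0; rewrite branch_parabola// => /(parabola_sqrt_open oW)[r r0 rP].
    by exists r => // q' q'0 q'q; rewrite branch_parabola//; exact: rP.
  - by [].
  - by rewrite b0.
  - exact: ne.
  - by split.
have ins q : 0 <= q <= dt P Nt -> dom P (branch P Nt n i a j b q).
  move=> /andP[]; rewrite le_eqVlt => /orP[/eqP<-|q0 qd]; first by rewrite b0.
  by apply: contrapT => nO; apply: ne; exists q; rewrite /exits/= q0.
have insd : dom P (branch P Nt n i a j b (dt P Nt)) by apply: ins; rewrite lexx ltW.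
split=> //; first by rewrite dt0 lexx.
- by move=> q /andP[q0 /ltW qd]; apply: ins; rewrite q0.
- exact: subset_closure.
Qed.

Lemma sroot_gt0 j b : 0 < s j b.
Proof. by rewrite sqrtr_gt0; have [/andP[]] := exit_timeP j b. Qed.

Lemma sroot_sqr j b : s j b ^+ 2 = d j b.
Proof. by rewrite sqr_sqrtr// ltW//; have [/andP[]] := exit_timeP j b. Qed.

Lemma theta_gt0 j : 0 < theta P Nt n i a j.
Proof. by rewrite mulr_gt0// sroot_gt0. Qed.

Lemma tau_gt0 : 0 < tau P c Nt n i a.
Proof.
have [M0 _ w0 _ _] := cub; rewrite invr_gt0 (bigD1 (Ordinal M0))//=.
rewrite ltr_wpDr ?divr_gt0 ?w0 ?theta_gt0//.
by apply: sumr_ge0 => j _; rewrite divr_ge0// ltW ?w0 ?theta_gt0.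
Qed.

Lemma omega_ge0 j b : 0 <= omega P Nt n i a j b.
Proof.
have [_ _ w0 _ _] := cub; rewrite divr_ge0//.
  by rewrite mulr_ge0// ltW ?w0// tau_gt0.
by rewrite ltW// mulr_gt0 ?addr_gt0// sroot_gt0.
Qed.

Lemma omega_bool j : \sum_(b : bool) omega P Nt n i a j b =
  tau P c Nt n i a * (wt c j / theta P Nt n i a j).
Proof.
rewrite big_bool/= /omega /theta.
have := sroot_gt0 j true; have := sroot_gt0 j false.
rewrite /s; move: (sroot _ _ _ _ _ _ true) (sroot _ _ _ _ _ _ false) (tau _ _ _ _ _ _).
by move=> s1 s0 t s00 s10; field; rewrite !gt_eqF// addr_gt0.
Qed.

Lemma omega_sum : \sum_(j < cM c) \sum_(b : bool) omega P Nt n i a j b = 1.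
Proof.
under eq_bigr do rewrite omega_bool.
by rewrite -mulr_sumr -[X in _ * X]invrK -/(tau _ _ _ _ _ _) mulfV// gt_eqF// tau_gt0.
Qed.

Lemma omega_time j : \sum_(b : bool) omega P Nt n i a j b * d j b =
  tau P c Nt n i a * wt c j.
Proof.
rewrite big_bool/= -!sroot_sqr /omega.
have := sroot_gt0 j true; have := sroot_gt0 j false.
rewrite /s; move: (sroot _ _ _ _ _ _ true) (sroot _ _ _ _ _ _ false) (tau _ _ _ _ _ _).
by move=> s1 s0 t s00 s10; field; rewrite !gt_eqF// addr_gt0.
Qed.

Lemma omega_centered j :
  \sum_(b : bool) omega P Nt n i a j b * ((-1) ^+ b * s j b) = 0.
Proof.
rewrite big_bool/= /omega /s.
have := sroot_gt0 j true; have := sroot_gt0 j false.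
rewrite /s; move: (sroot _ _ _ _ _ _ true) (sroot _ _ _ _ _ _ false) (tau _ _ _ _ _ _).
by move=> s1 s0 t s00 s10; rewrite expr1 expr0; field; rewrite !gt_eqF// addr_gt0.
Qed.

(** The weights annihilate the first order terms although the two branches of
   a pair may stop at different times, and tau is their mean time step. *)
Lemma weighted_expansion (X : 'I_(cM c) -> bool -> R) (al be : 'I_(cM c) -> R) (e : R) :
  (forall j b, `|X j b - ((-1) ^+ b * s j b * al j + d j b * be j)| <= d j b * e) ->
  `|(\sum_j \sum_(b : bool) omega P Nt n i a j b * X j b) / tau P c Nt n i a
     - \sum_j wt c j * be j| <= e.
Proof.
move=> Xe; have t0 := tau_gt0; have [_ _ w0 w1 _] := cub.
set t := tau _ _ _ _ _ _ in t0 *.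
have -> : (\sum_j \sum_(b : bool) omega P Nt n i a j b * X j b) / t
     - \sum_j wt c j * be j =
  (\sum_j \sum_(b : bool) omega P Nt n i a j b *
    (X j b - ((-1) ^+ b * s j b * al j + d j b * be j))) / t.
  rewrite -[X in _ - X](mulfK (lt0r_neq0 t0)) -mulrBl; congr (_ / _).
  rewrite mulr_suml -sumrB; apply: eq_bigr => j _.
  have -> : wt c j * be j * t =
      \sum_(b : bool) omega P Nt n i a j b * ((-1) ^+ b * s j b * al j + d j b * be j).
    have := omega_time j; have := omega_centered j.
    rewrite !big_bool/= -/t.
    move: (omega _ _ _ _ _ _ true) (omega _ _ _ _ _ _ false) => o1 o0.
    move: (s j true) (s j false) (d j true) (d j false) => s1 s0 d1 d0 oc ot.
    transitivity (t * wt c j * be j); first by ring.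
    rewrite -ot -[LHS]addr0 -[0 in LHS](mul0r (al j)) -oc; ring.
  by rewrite -sumrB; apply: eq_bigr => b _; rewrite mulrBr.
have tV : 0 < t^-1 by rewrite invr_gt0.
rewrite normrM (gtr0_norm tV) (ler_pdivrMr _ _ t0).
apply: le_trans (ler_norm_sum _ _ _) _.
have -> : e * t = \sum_j t * wt c j * e.
  by rewrite -mulr_suml -mulr_sumr w1 mulr1 mulrC.
apply: ler_sum => j _; apply: le_trans (ler_norm_sum _ _ _) _.
rewrite -omega_time mulr_suml; apply: ler_sum => b _.
rewrite normrM (ger0_norm (omega_ge0 j b)) -[leRHS]mulrA.
by apply: ler_wpM2l => //; exact: omega_ge0.
Qed.

End Row.

Section Consistency.
Context {R : realType} {N p : nat} {A : metricType R}.

Definition data_bound (P : hjb_data R N p A) (c : cubature R p) (K : R) :=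
  forall z a, Qcl P z ->
    [/\ `|mu P z a| <= K, forall j, `|sigma P z a *m eta c j| <= K,
        `|rate P z a| <= K & `|cost P z a| <= K].

(** A stopped branch reads the boundary data instead of w.  When the two agree,
   stopping causes no error at all. *)
Definition matches_data (P : hjb_data R N p A) (w : jet R N) :=
  (forall z, lateral P z -> w z = ubd P z) /\
  (forall y, bdry (dom P) y -> w (horizon P, y) = Psi P y).

(** The factor 1 / (1 + r d) agrees with 1 - r d up to O(d^2), and v may be
   replaced by the nearby value U in the term of order d. *)
Lemma discount_error (r d v U B e K : R) :
  0 <= r <= K -> 0 <= d -> `|v| <= B -> `|v - U| <= e ->
  `|v / (1 + r * d) - (v - r * d * U)| <= d * (K * (e + B * (K * d))).
Proof.
move=> /andP[r0 rK] d0 vB ve.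
have rd0 : 0 <= r * d by rewrite mulr_ge0.
have rd1 : 0 < 1 + r * d by rewrite ltr_pwDl.
have -> : v / (1 + r * d) - (v - r * d * U) =
    - (d * (r * ((v - U) - v * (r * d / (1 + r * d))))).
  by field; rewrite gt_eqF.
rewrite normrN normrM ger0_norm// ler_wpM2l// normrM ger0_norm//.
apply: ler_pM => //; apply: le_trans (ler_normB _ _) _; apply: lerD => //.
rewrite normrM; apply: ler_pM => //.
have q0 : 0 <= r * d / (1 + r * d) by rewrite divr_ge0// ltW.
rewrite (ger0_norm q0); apply: (@le_trans _ _ (r * d)).
  by rewrite ler_pdivrMr// ler_peMr// lerDl.
by rewrite ler_wpM2r.
Qed.

Variables (P : hjb_data R N p A) (c : cubature R p).
Variables (g C K : R) (Cbd Cp Cpatch : R).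
Hypotheses (oO : open (dom P)) (C0 : 0 <= C).

Let Ei : R := N%:R * C * `|Cp| + 3 * N%:R ^+ 2 * C * Cpatch ^+ 2.

Lemma interp_constant_ge0 : 0 <= Ei.
Proof.
apply: addr_ge0; first by do 2![apply: mulr_ge0 => //].
do 2![apply: mulr_ge0; last by rewrite ?sqr_ge0].
by apply: mulr_ge0 => //; exact: exprn_ge0.
Qed.

Lemma vtx_domain (m : mesh R N) k : mesh_G1 m (dom P) ->
  dom P (vtx m k) \/ bdry (dom P) (vtx m k).
Proof.
move=> [rE rO]; have [b|nb] := pselect (bdry (domh m) (vtx m k)); last first.
  by left; exact: rO.
right; suff [] : (range (vtx m) `&` bdry (dom P)) (vtx m k) by [].
by rewrite -rE; split=> //; exists k.
Qed.

Lemma interp_hat (m : mesh R N) (x : 'cV[R]_N) : triangulation m ->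
  nodal_basis m -> mesh_G4 m (dom P) Cbd Cp -> closure (dom P) x ->
  [/\ forall k, 0 <= hat m k (proj m x), \sum_k hat m k (proj m x) = 1 &
      \sum_k hat m k (proj m x) *: vtx m k = proj m x].
Proof. by move=> tm nb [_ pc _ _] cx; apply: hat_partition => //; exact: pc. Qed.

(** End points that are vertices are interpolated exactly; at the others the
   patch conditions bound the error. *)
Lemma interp_error (m : mesh R N) (Nt n : nat) (i : 'I_(nv m)) a (j : 'I_(cM c)) b w t :
  mesh_ok P c m Nt Cbd Cp Cpatch -> (n < Nt)%N -> 0 < dt P Nt ->
  tame (horizon P) (dom P) g C w -> 0 <= t <= horizon P ->
  dom P (vtx m i) -> ~~ stopped P Nt n i a j b ->
  `|interp (fun k => w (t, vtx m k)) (branch P Nt n i a j b (dt P Nt))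
     - w (t, branch P Nt n i a j b (dt P Nt))| <= Ei * meshsize m ^+ 2.
Proof.
move=> [[tm nb G1] [_ G4 patch]] nNt dt0 tw tT Oi ns.
have [_ _ _] := exit_timeP n a oO Oi dt0 j b; rewrite (negbTE ns) => -[_ Ox].
set x := branch _ _ _ _ _ _ _ _ in Ox *.
have [h0 h1 hx] := interp_hat tm nb G4 (subset_closure Ox).
have [_ _ pv pC] := G4.
have h20 : 0 <= meshsize m ^+ 2 by exact: sqr_ge0.
have Ei0 := interp_constant_ge0.
have [[k _ kx]|nr] := pselect (range (vtx m) x).
  rewrite /interp -kx pv (bigD1 k)//=.
  have hk l : hat m l (vtx m k) = (l == k)%:R by have [] := nb l.
  rewrite hk eqxx mul1r big1 ?addr0 => [|l lk].
    by rewrite subrr normr0 mulr_ge0.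
  by rewrite hk (negbTE lk) mul0r.
have Xx : Xh P c m Nt x by split=> //; exists n, i, a, j, b.
apply: le_trans (convex_combination_error
  (lam := fun l => hat m l (proj m x)) (e := `|Cp| * meshsize m ^+ 2)
  (d := Cpatch * meshsize m) oO tw tT Ox h0 h1 _ _) _.
- rewrite hx; apply: le_trans (mx_norm_le_enorm _) _.
  apply: le_trans (pC _ (subset_closure Ox)) _.
  by rewrite ler_wpM2r// ler_norm.
- move=> l hl; have [e1 e2 e3] := patch x l Xx hl; split=> //.
    exact: le_trans (mx_norm_le_enorm _) e1.
  by have := e2 1; rewrite subrr scale0r add0r scale1r lexx ler01; exact.
- by rewrite exprMn /Ei; lra.
Qed.

(** Only branches that run for the full step dt are interpolated, so the error
   h^2 can be charged to the elapsed time as d h^2 / dt. *)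
Lemma continuation_error (m : mesh R N) (Nt n : nat) (i : 'I_(nv m)) a (j : 'I_(cM c)) b w :
  mesh_ok P c m Nt Cbd Cp Cpatch -> (n < Nt)%N -> 0 < dt P Nt ->
  0 <= tn P Nt n -> tn P Nt n + dt P Nt <= horizon P ->
  tame (horizon P) (dom P) g C w -> matches_data P w ->
  dom P (vtx m i) ->
  `|continuation P Nt n i a (fun k => w (tn P Nt n.+1, vtx m k)) j b
     - w (tn P Nt n + exit_time P Nt n i a j b,
          branch P Nt n i a j b (exit_time P Nt n i a j b))|
  <= exit_time P Nt n i a j b * (Ei * (meshsize m ^+ 2 / dt P Nt)).
Proof.
move=> mok nNt dt0 t0 tT tw [wu wP] Oi; set d := exit_time _ _ _ _ _ _ _.
have [/andP[d0 dle] _ cl st] := exit_timeP n a oO Oi dt0 j b.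
rewrite -/d in d0 dle cl st.
have Ei0 := interp_constant_ge0.
have rhs0 : 0 <= d * (Ei * (meshsize m ^+ 2 / dt P Nt)).
  by rewrite mulr_ge0 ?(ltW d0)// mulr_ge0// divr_ge0 ?sqr_ge0// ltW.
rewrite /continuation -/d; case: ifPn st => [_ nO|ns [dE _]].
  have bd : bdry (dom P) (branch P Nt n i a j b d).
    by split=> //; move=> /interior_subset.
  case: ifPn => [/eqP tE|_].
    by rewrite -wP// tE subrr normr0.
  rewrite wu ?subrr ?normr0//; split=> //=.
  by rewrite in_itv/= addr_ge0 ?(ltW d0)//= (le_trans _ tT)// lerD2l.
rewrite dE; have tS : tn P Nt n.+1 = tn P Nt n + dt P Nt.
  by rewrite /tn -natr1 mulrDl mul1r.
rewrite tS mulrCA [dt P Nt * _]mulrC divfK ?gt_eqF//.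
apply: interp_error => //.
by rewrite addr_ge0// ltW.
Qed.

Hypotheses (g01 : 0 < g <= 1) (K0 : 0 <= K) (cub : cubature_ok c).
Hypothesis rate_ge0 : forall z a, Qcl P z -> 0 <= rate P z a.
Hypothesis data_le : data_bound P c K.

(** On stopped rows and full rows alike every branch contributes an error
   proportional to its own running time, which the weights average to tau. *)
Lemma residual_consistency : exists2 E, 0 <= E &
  forall (m : mesh R N) (Nt n : nat) (i : 'I_(nv m)) a w,
  mesh_ok P c m Nt Cbd Cp Cpatch -> (n < Nt)%N -> 0 < dt P Nt <= 1 ->
  0 <= tn P Nt n -> tn P Nt n + dt P Nt <= horizon P ->
  tame (horizon P) (dom P) g C w -> matches_data P w -> dom P (vtx m i) ->
  `|residual P c Nt n i a (w (tn P Nt n, vtx m i))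
       (fun k => w (tn P Nt n.+1, vtx m k))
     - Fop P a w (tn P Nt n, vtx m i)|
  <= E * (dt P Nt `^ (g / 2) + meshsize m ^+ 2 / dt P Nt).
Proof.
have [E E0 EP] := jet_branch_bounds (horizon P) oO g01 C0 K0.
have Ei0 := interp_constant_ge0.
pose E1 := E + K * E + K * C * K; pose E2 := 1 + K + K * K.
have E10 : 0 <= E1 by rewrite /E1 !addr_ge0// !mulr_ge0.
have E20 : 0 <= E2 by rewrite /E2 !addr_ge0// !mulr_ge0.
exists (E1 + E2 * Ei); first by rewrite addr_ge0// mulr_ge0.
move=> m Nt n i a w mok nNt /andP[dt0 dt1] t0 tT tw md Oi.
case/andP: (g01) => g0 g1.
set x := vtx m i in Oi *; set t := tn P Nt n in t0 tT *; set U := w (t, x).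
set D := dt P Nt `^ (g / 2); set h2 := meshsize m ^+ 2 / dt P Nt.
have D0 : 0 <= D by exact: powR_ge0.
have h20 : 0 <= h2 by rewrite divr_ge0 ?sqr_ge0// ltW.
have zcl : Qcl P (t, x).
  split; last exact: subset_closure.
  by rewrite /= in_itv/= t0 (le_trans _ tT)// lerDl ltW.
have [muK noiseK rK fK] := data_le a zcl.
have r0 := rate_ge0 a zcl.
pose X (j : 'I_(cM c)) b :=
  continuation P Nt n i a (fun k => w (tn P Nt n.+1, vtx m k)) j b
    / (1 + rate P (t, x) a * exit_time P Nt n i a j b)
  + cost P (t, x) a * exit_time P Nt n i a j b - U.
pose al (j : 'I_(cM c)) := dotp (jx w (t, x)) (sigma P (t, x) a *m eta c j).
pose base := jt w (t, x) + dotp (jx w (t, x)) (mu P (t, x) a)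
  - rate P (t, x) a * U + cost P (t, x) a.
pose be (j : 'I_(cM c)) :=
  base + 2^-1 * quadf (jxx w (t, x)) (sigma P (t, x) a *m eta c j).
have -> : residual P c Nt n i a U (fun k => w (tn P Nt n.+1, vtx m k)) =
  (\sum_j \sum_(b : bool) omega P Nt n i a j b * X j b) / tau P c Nt n i a.
  have US : U = \sum_(j < cM c) \sum_(b : bool) omega P Nt n i a j b * U.
    under eq_bigr do rewrite -mulr_suml.
    by rewrite -mulr_suml (omega_sum n a oO Oi dt0 cub) mul1r.
  rewrite /residual /Sa; congr (_ / _).
  rewrite [X in _ - X]US -sumrB; apply: eq_bigr => j _.
  by rewrite -sumrB; apply: eq_bigr => b _; rewrite -mulrBr.
have -> : Fop P a w (t, x) = \sum_j wt c j * be j.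
  have [_ _ _ w1 _] := cub.
  under eq_bigr do rewrite mulrDr mulrCA.
  rewrite big_split/= -mulr_suml w1 mul1r -mulr_sumr (cubature_quadf _ _ cub).
  by rewrite /Fop /Lop /base -/U -/x -/t [dotp (mu _ _ _) _]dotpC; ring.
have -> : (E1 + E2 * Ei) * (D + h2) = E1 * D + E2 * (Ei * h2)
   + (E1 * h2 + E2 * Ei * D) by ring.
apply: (@le_trans _ _ (E1 * D + E2 * (Ei * h2))); last first.
  rewrite lerDl; apply: addr_ge0; first exact: mulr_ge0.
  by apply: mulr_ge0 => //; exact: mulr_ge0.
apply: (weighted_expansion (al := al) oO Oi dt0 cub) => j b.
have [/andP[d0 dle] ins cl _] := exit_timeP n a oO Oi dt0 j b.
have s0 := sroot_gt0 n a oO Oi dt0 j b.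
have s2 := sroot_sqr n a oO Oi dt0 j b.
have ce := continuation_error a j b mok nNt dt0 t0 tT tw md Oi.
rewrite /X; move: ce; set V := continuation _ _ _ _ _ _ _ _.
set s := sroot _ _ _ _ _ _ _ in s0 s2 *.
set d := exit_time _ _ _ _ _ _ _ in d0 dle ins cl s2 *.
pose v := (-1) ^+ b *: (sigma P (t, x) a *m eta c j).
have sgn1 : (-1) ^+ b * (-1) ^+ b = 1 :> R by rewrite -expr2 sqrr_sign.
have vK : `|v| <= K by rewrite normrZ normr_sign mul1r.
have sE : s = Num.sqrt d by [].
have d1 : d <= 1 by exact: le_trans dt1.
have s1 : s <= 1 by rewrite sE -[leRHS]sqrtr1 ler_sqrt.
have brE : branch P Nt n i a j b d = parabola x (mu P (t, x) a) v s.
  by rewrite branch_parabola// ltW.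
rewrite brE -/h2 -/t -s2.
have s01 : 0 < s <= 1 by rewrite s0.
have tsT : t + s ^+ 2 <= horizon P by rewrite s2 (le_trans _ tT)// lerD2l.
have insp r : 0 <= r < s -> dom P (parabola x (mu P (t, x) a) v r).
  move=> /andP[r00 rs]; have := ins (r ^+ 2).
  rewrite branch_parabola ?sqr_ge0// sqrtr_sqr ger0_norm//; apply.
  by rewrite -s2 ltrXn2r// sqr_ge0.
have clp : closure (dom P) (parabola x (mu P (t, x) a) v s) by rewrite -brE.
have [W1 W2] := EP w t x _ v s tw t0 s01 tsT muK vK insp clp.
have sgD : s `^ g <= D.
  have -> : s `^ g = d `^ (g / 2).
    by rewrite sE -powR12_sqrt ?(ltW d0)// -powRrM mulrC.
  by apply: ge0_ler_powR; rewrite ?nnegrE ?(ltW d0) ?(ltW dt0)// divr_ge0// ltW.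
have ssg : s <= s `^ g by apply: ger1_powR.
have s2sg : s ^+ 2 <= s `^ g.
  by apply: le_trans ssg; rewrite expr2 ler_piMl// ltW.
have [_ _ sw _ _] := tw.
have WC : `|w (t + s ^+ 2, parabola x (mu P (t, x) a) v s)| <= C.
  have [|] := sw (t + s ^+ 2, parabola x (mu P (t, x) a) v s).
    by split; rewrite //= in_itv/= tsT addr_ge0 ?sqr_ge0.
  by [].
move: W1 W2 WC; set W := w (t + s ^+ 2, _); rewrite -/U => W1 W2 WC VW.
set eta0 := Ei * h2 in VW *.
have eta00 : 0 <= eta0 by rewrite mulr_ge0.
have s20 : 0 <= s ^+ 2 by exact: sqr_ge0.
have s21 : s ^+ 2 <= 1 by rewrite s2.
have VB : `|V| <= C + s ^+ 2 * eta0.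
  by rewrite -[V](subrK W) addrC (le_trans (ler_normD _ _))// lerD.
have VU : `|V - U| <= E * D + eta0.
  have -> : V - U = (W - U) + (V - W) by ring.
  apply: le_trans (ler_normD _ _) _; apply: lerD.
    by apply: le_trans W1 _; rewrite ler_wpM2l.
  by apply: le_trans VW _; rewrite ler_piMl.
have rKK : 0 <= rate P (t, x) a <= K by rewrite r0 (le_trans (ler_norm _)).
have de := discount_error rKK s20 VB VU.
have -> : V / (1 + rate P (t, x) a * s ^+ 2) + cost P (t, x) a * s ^+ 2 - U
    - ((-1) ^+ b * s * al j + s ^+ 2 * be j) =
  (V / (1 + rate P (t, x) a * s ^+ 2) - (V - rate P (t, x) a * s ^+ 2 * U))
  + (V - W)
  + (W - U - s * dotp (jx w (t, x)) v - s ^+ 2 * (jt w (t, x) +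
      (dotp (jx w (t, x)) (mu P (t, x) a) + 2^-1 * quadf (jxx w (t, x)) v))).
  rewrite /v /be /base /al dotpZr.
  have -> : quadf (jxx w (t, x)) ((-1) ^+ b *: (sigma P (t, x) a *m eta c j)) =
      quadf (jxx w (t, x)) (sigma P (t, x) a *m eta c j).
    by rewrite /quadf -scalemxAr dotpZr dotpC dotpZr mulrA sgn1 mul1r dotpC.
  ring.
have f1 : s ^+ 2 * (K * (E * D + eta0 + (C + s ^+ 2 * eta0) * (K * s ^+ 2))) <=
    s ^+ 2 * (K * (E * D + eta0 + (C * D + eta0) * K)).
  rewrite ler_wpM2l// ler_wpM2l// lerD2l [K * s ^+ 2]mulrC mulrA ler_wpM2r//.
  rewrite mulrDl lerD//.
    by rewrite ler_wpM2l// (le_trans s2sg).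
  apply: (@le_trans _ _ (s ^+ 2 * eta0)); last exact: ler_piMl.
  by apply: ler_piMr => //; exact: mulr_ge0.
have f2 : E * (s ^+ 2 * s `^ g) <= s ^+ 2 * (E * D).
  by rewrite mulrCA ler_wpM2l// ler_wpM2l.
apply: le_trans (ler_normD _ _) _.
apply: le_trans (lerD (ler_normD _ _) (lexx _)) _.
apply: le_trans (lerD (lerD (le_trans de f1) VW) (le_trans W2 f2)) _.
by rewrite /E1 /E2 le_eqVlt; apply/orP; left; apply/eqP; ring.
Qed.

End Consistency.

(** * Comparison with barriers *)

Section Comparison.
Context {R : realType} {N p : nat} {A : metricType R}.
Notation V := 'cV[R]_N.

Lemma Lop_lin (P : hjb_data R N p A) a k (w1 w2 : jet R N) z :
  Lop P a (jet_lin k w1 w2) z = Lop P a w1 z + k * Lop P a w2 z.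
Proof.
by rewrite /Lop /= mulmxDr mxtraceD -scalemxAr mxtraceZ dotpDr dotpZr; ring.
Qed.

Lemma Fop_lin (P : hjb_data R N p A) a k (w1 w2 : jet R N) z :
  Fop P a (jet_lin k w1 w2) z = Fop P a w1 z + k * Lop P a w2 z.
Proof. by rewrite /Fop Lop_lin addrAC. Qed.

Lemma Lop_cst (P : hjb_data R N p A) a (k : R) z :
  Lop P a (jet_cst k) z = - (rate P z a * k).
Proof.
rewrite /Lop /= mulmx0 mxtrace0 mulr0 addr0 add0r /dotp big1 ?sub0r//.
by move=> i _; rewrite mxE mulr0.
Qed.

(** Extended sums are bounded termwise only if every term is nonnegative, that
   is, if no supremum is taken over the empty set; for the lateral datum this
   needs a boundary point. *)
Lemma data_bounds (P : hjb_data R N p A) (c : cubature R p) :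
  (0 < N)%N -> bounded_domain (dom P) -> 0 < horizon P -> bounded_domain_data P ->
  exists2 K : R, 0 <= K & data_bound P c K.
Proof.
move=> N0 [oO cO neO bO] T0 [K0 [K00 [le_K0 _ _ _ _]]].
have [x Ox] := neO; have [y bdy] := bdry_nonempty N0 oO neO bO.
have z0 : Qcl P (0, x).
  by split; [rewrite /= in_itv/= lexx ltW|exact: subset_closure].
have sup0 (X : Type) (U : set X) (f : X -> R) u : U u -> (0 <= supnorm U f)%E.
  move=> Uu; apply: (@le_trans _ _ (`|f u|)%:E); first by rewrite lee_fin.
  by apply: ereal_sup_ubound; exists u.
have s1 : (0 <= supnorm (closure (dom P)) (Psi P))%E.
  exact: sup0 (subset_closure Ox).
have s2 : (0 <= supnorm (lateral P) (ubd P))%E.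
  by apply: (sup0 _ _ _ (0, y)); split; rewrite //= in_itv/= lexx ltW.
move: le_K0; set S := [set _ | a in _] => le_K0.
have le3 a : (supnorm (Qcl P) (fun z => enorm (sigma P z a))
    + supnorm (Qcl P) (fun z => enorm (mu P z a))
    + supnorm (Qcl P) (fun z => rate P z a)
    + supnorm (Qcl P) (fun z => cost P z a) <= K0%:E)%E.
  apply: le_trans (_ : _ <= ereal_sup S)%E _; first by apply: ereal_sup_ubound; exists a.
  by apply: le_trans le_K0; rewrite leeDr// adde_ge0.
have sup_le (f : R * V -> R) z : Qcl P z -> (supnorm (Qcl P) f <= K0%:E)%E ->
    `|f z| <= K0.
  move=> Qz; rewrite -lee_fin; apply: le_trans.
  by apply: ereal_sup_ubound; exists z.
pose L := K0 + p%:R * (K0 * \sum_j `|eta c j|).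
have S0 : 0 <= \sum_j `|eta c j| by exact: sumr_ge0.
have q0 : 0 <= p%:R * (K0 * \sum_j `|eta c j|).
  by apply: mulr_ge0 => //; apply: mulr_ge0 => //; exact: ltW.
have K0L : K0 <= L by rewrite lerDl.
exists L; first by rewrite addr_ge0// ltW.
move=> z a Qz; have := le3 a.
set f1 := supnorm _ _; set f2 := supnorm _ _; set f3 := supnorm _ _.
set f4 := supnorm _ _ => le4.
have f10 : (0 <= f1)%E by exact: sup0 z0.
have f20 : (0 <= f2)%E by exact: sup0 z0.
have f30 : (0 <= f3)%E by exact: sup0 z0.
have f40 : (0 <= f4)%E by exact: sup0 z0.
have l1 : (f1 <= K0%:E)%E.
  by apply: le_trans le4; rewrite -!addeA leeDl// !adde_ge0.
have l2 : (f2 <= K0%:E)%E.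
  by apply: le_trans le4; rewrite [(f1 + _)%E]addeC -!addeA leeDl// !adde_ge0.
have l3 : (f3 <= K0%:E)%E.
  apply: le_trans le4; rewrite -addeA.
  by apply: (@le_trans _ _ (f3 + f4)%E); rewrite ?leeDl ?leeDr ?adde_ge0.
have l4 : (f4 <= K0%:E)%E by apply: le_trans le4; rewrite leeDr// !adde_ge0.
have sig := sup_le _ z Qz l1; have mul := sup_le _ z Qz l2.
split.
- apply: le_trans (mx_norm_le_enorm _) _; apply: le_trans K0L.
  exact: le_trans (ler_norm _) mul.
- move=> j; apply: le_trans (mulmx_norm_le _ _) _.
  rewrite /L ler_wpDl ?(ltW K00)//; apply: ler_wpM2l => //; apply: ler_pM => //.
    apply: le_trans (mx_norm_le_enorm _) _.
    exact: le_trans (ler_norm _) sig.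
  by rewrite (bigD1 j)//= lerDl sumr_ge0.
- exact: le_trans (sup_le _ z Qz l3) K0L.
- exact: le_trans (sup_le _ z Qz l4) K0L.
Qed.

Section Bounds.
Variables (P : hjb_data R N p A) (c : cubature R p) (g C K : R).
Hypotheses (C0 : 0 <= C) (K0 : 0 <= K) (cub : cubature_ok c).
Hypothesis data_le : data_bound P c K.

(** Uniformity in the control makes the infimum over the controls a genuine
   greatest lower bound in R. *)
Lemma Fop_bounded : exists B : R, forall w z a,
  tame (horizon P) (dom P) g C w -> Qcl P z -> `|Fop P a w z| <= B.
Proof.
exists (C + N%:R ^+ 2 * (C * K ^+ 2) + N%:R * (K * C) + K * C + K) => w z a tw Qz.
have [muK nK rK fK] := data_le a Qz.
have [_ _ sw _ _] := tw; have [wC tC xC xxC] := sw z Qz.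
have [_ _ w0 w1 _] := cub.
rewrite /Fop /Lop -(cubature_quadf _ _ cub).
have h1 : `|2^-1 * \sum_j wt c j * quadf (jxx w z) (sigma P z a *m eta c j)|
    <= N%:R ^+ 2 * (C * K ^+ 2).
  rewrite normrM ger0_norm//.
  have q0 : 0 <= N%:R ^+ 2 * (C * K ^+ 2).
    by apply: mulr_ge0; rewrite ?exprn_ge0// mulr_ge0// exprn_ge0.
  have h : `|\sum_j wt c j * quadf (jxx w z) (sigma P z a *m eta c j)|
      <= N%:R ^+ 2 * (C * K ^+ 2).
    apply: le_trans (ler_norm_sum _ _ _) _.
    have -> : N%:R ^+ 2 * (C * K ^+ 2) =
        \sum_j wt c j * (N%:R ^+ 2 * (C * K ^+ 2)) by rewrite -mulr_suml w1 mul1r.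
    apply: ler_sum => j _.
    rewrite normrM gtr0_norm ?w0//; apply: ler_wpM2l; first exact/ltW/w0.
    apply: le_trans (quadf_le _ _) _; apply: ler_wpM2l; first exact: exprn_ge0.
    by apply: ler_pM => //; rewrite ?exprn_ge0// lerXn2r// nnegrE.
  lra.
have h2 : `|dotp (mu P z a) (jx w z)| <= N%:R * (K * C).
  by apply: le_trans (dotp_le _ _) _; rewrite ler_wpM2l// ler_pM.
have h3 : `|rate P z a * w z| <= K * C by rewrite normrM ler_pM.
move: h1 h2 h3 tC fK; rewrite !ler_norml => /andP[? ?] /andP[? ?] /andP[? ?].
by move=> /andP[? ?] /andP[? ?]; apply/andP; split; lra.
Qed.

End Bounds.

Section Viscosity.
Variables (P : hjb_data R N p A) (u : R * V -> R) (w : jet R N) (B K : R).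
Hypotheses (bO : bounded_set (dom P)) (A0 : [set: A] !=set0).
Hypothesis rate_ge0 : forall z a, Qcl P z -> 0 <= rate P z a.
Hypothesis bounds :
  forall z a, Qcl P z -> `|Fop P a w z| <= B /\ `|rate P z a| <= K.
Hypothesis cu : {within Qcl P, continuous u}.
Hypothesis cw : {within Qcl P, continuous w}.
Hypothesis C12w : C12 (horizon P) (dom P) w.

Lemma Qcl_cases z : Qcl P z ->
  [\/ QT P z, (`[0, horizon P[ `*` bdry (dom P)) z |
      z.1 = horizon P /\ closure (dom P) z.2].
Proof.
case: z => t x [/= + cx]; rewrite in_itv/= => /andP[t0].
rewrite le_eqVlt => /orP[/eqP tT|tT]; first by constructor 3.
have [Ox|nOx] := pselect (dom P x).
  by constructor 1; split; rewrite //= in_itv/= t0.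
constructor 2; split; rewrite /= ?in_itv/= ?t0//.
by split=> // /interior_subset.
Qed.

Lemma Qcl_compact : compact (Qcl P).
Proof.
by apply: compact_setX; [exact: segment_compact|exact: bounded_closure_compact].
Qed.

Lemma shifted_test (M : R) :
  let phi := jet_lin 1 w (jet_cst M) in
  [/\ C12 (horizon P) (dom P) phi, forall z, phi z = w z + M &
      forall z a, Fop P a phi z = Fop P a w z - rate P z a * M].
Proof.
split; first by apply: C12_lin => //; exact: C12_cst.
  by move=> z; rewrite /= mul1r.
by move=> z a; rewrite Fop_lin Lop_cst mul1r.
Qed.

(** At a positive maximum of u - w off the parabolic boundary, w raised by this
   maximum is an admissible test function, and discounting makes it an even
   stricter supersolution.  Comparison with a smooth function thus needs no
   doubling of variables. *)
Lemma subsolution_le_smooth : strong_subsolution P u ->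
  (forall z a, QT P z -> Fop P a w z < 0) ->
  (forall z, (`[0, horizon P[ `*` bdry (dom P)) z -> ubd P z <= w z) ->
  (forall x, closure (dom P) x -> Psi P x <= w (horizon P, x)) ->
  forall z, Qcl P z -> u z <= w z.
Proof.
move=> [_ visc lat ter] Fneg wlat wter z Qz.
have cuw : {within Qcl P, continuous (fun z => u z - w z)}.
  by move=> y; apply: cvgB; [exact: cu|exact: cw].
have [y + ymax] := compact_EVT_max (ex_intro _ z Qz) Qcl_compact cuw.
rewrite inE => Qy; pose M := u y - w y.
have zM : u z - w z <= M by apply: ymax; rewrite inE.
rewrite -subr_le0; apply: le_trans zM _; rewrite leNgt; apply/negP => M0.
have [Ty|Ly|[tT cx]] := Qcl_cases Qy; last first.
- have := ter _ cx; have := wter _ cx; rewrite -tT.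
  by move: M0; rewrite /M; case: (y) => ? ? /=; lra.
- by have := lat _ Ly; have := wlat _ Ly; move: M0; rewrite /M; lra.
have [Cphi phiE Fphi] := shifted_test M; set phi := jet_lin _ _ _ in Cphi phiE Fphi.
have : 0 <= infF P phi y.
  apply: visc => //; last by rewrite phiE /M; ring.
  apply: (filterS _ (withinT _ _)) => y' Qy'; rewrite !phiE.
  by have := ymax y'; rewrite inE => /(_ Qy'); lra.
apply/negP; rewrite -ltNge; have [a _] := A0.
apply: (@le_lt_trans _ _ (Fop P a phi y)).
  apply: ge_inf; last by exists a.
  exists (- B - K * M) => _ [a' _ <-]; rewrite Fphi.
  have [] := bounds a' Qy; rewrite !ler_norml => /andP[h1 _] /andP[_ h2].
  have : rate P y a' * M <= K * M by rewrite ler_wpM2r// ltW.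
  lra.
rewrite Fphi; have := Fneg y a Ty; have := rate_ge0 a Qy.
move=> r0 F0; have : 0 <= rate P y a * M by rewrite mulr_ge0// ltW.
lra.
Qed.

(** Here the infimum over the controls must stay positive, which the uniform
   margin k ensures. *)
Lemma smooth_le_supersolution (k : R) : 0 < k -> strong_supersolution P u ->
  (forall z a, QT P z -> k <= Fop P a w z) ->
  (forall z, (`[0, horizon P[ `*` bdry (dom P)) z -> w z <= ubd P z) ->
  (forall x, closure (dom P) x -> w (horizon P, x) <= Psi P x) ->
  forall z, Qcl P z -> w z <= u z.
Proof.
move=> k0 [_ visc lat ter] Fpos wlat wter z Qz.
have cuw : {within Qcl P, continuous (fun z => w z - u z)}.
  by move=> y; apply: cvgB; [exact: cw|exact: cu].
have [y + ymax] := compact_EVT_max (ex_intro _ z Qz) Qcl_compact cuw.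
rewrite inE => Qy; pose M := w y - u y.
have zM : w z - u z <= M by apply: ymax; rewrite inE.
rewrite -subr_le0; apply: le_trans zM _; rewrite leNgt; apply/negP => M0.
have [Ty|Ly|[tT cx]] := Qcl_cases Qy; last first.
- have := ter _ cx; have := wter _ cx; rewrite -tT.
  by move: M0; rewrite /M; case: (y) => ? ? /=; lra.
- by have := lat _ Ly; have := wlat _ Ly; move: M0; rewrite /M; lra.
have [Cphi phiE Fphi] := shifted_test (- M).
set phi := jet_lin _ _ _ in Cphi phiE Fphi.
have : infF P phi y <= 0.
  apply: visc => //; last by rewrite phiE /M; ring.
  apply: (filterS _ (withinT _ _)) => y' Qy'; rewrite !phiE.
  by have := ymax y'; rewrite inE => /(_ Qy'); lra.
apply/negP; rewrite -ltNge; apply: lt_le_trans k0 _; have [a _] := A0.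
apply: lb_le_inf; first by exists (Fop P a phi y), a.
move=> _ [a' _ <-]; rewrite Fphi; have := Fpos y a' Ty; have := rate_ge0 a' Qy.
move=> r0 F0; have : 0 <= rate P y a' * M by rewrite mulr_ge0// ltW.
lra.
Qed.

End Viscosity.

Section Discrete.
Variables (P : hjb_data R N p A) (c : cubature R p) (m : mesh R N) (Nt : nat).
Variables (Cbd Cp Cpatch : R).
Hypotheses (oO : open (dom P)) (cub : cubature_ok c) (dt0 : 0 < dt P Nt).
Hypothesis A0 : [set: A] !=set0.
Hypothesis rate_ge0 : forall z a, Qcl P z -> 0 <= rate P z a.
Hypothesis mok : mesh_ok P c m Nt Cbd Cp Cpatch.

Lemma tn_itv n : (n < Nt)%N -> 0 <= tn P Nt n /\ tn P Nt n + dt P Nt <= horizon P.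
Proof.
move=> nNt; have Nt0 : (0 < Nt)%N by exact: leq_ltn_trans nNt.
split; first by rewrite mulr_ge0// ltW.
have -> : tn P Nt n + dt P Nt = n.+1%:R * dt P Nt.
  by rewrite /tn -natr1 mulrDl mul1r.
have -> : horizon P = Nt%:R * dt P Nt.
  by rewrite /dt mulrCA mulfV ?mulr1// pnatr_eq0 -lt0n.
by rewrite ler_wpM2r ?ler_nat// ltW.
Qed.

Lemma Sa_monotone n i a (Phi Phi' : 'I_(nv m) -> R) : (n < Nt)%N ->
  dom P (vtx m i) -> (forall k, Phi k <= Phi' k) ->
  Sa P c Nt n i a Phi <= Sa P c Nt n i a Phi'.
Proof.
move=> nNt Oi le_Phi; have [t0 tT] := tn_itv nNt.
have zcl : Qcl P (tn P Nt n, vtx m i).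
  split; last exact: subset_closure.
  by rewrite /= in_itv/= t0 (le_trans _ tT)// lerDl ltW.
apply: ler_sum => j _; apply: ler_sum => b _.
apply: ler_wpM2l; first exact: omega_ge0.
have [/andP[d0 _] _ _ st] := exit_timeP n a oO Oi dt0 j b.
rewrite lerD2r; apply: ler_wpM2r.
  by rewrite invr_ge0 addr_ge0// mulr_ge0 ?(ltW d0)// rate_ge0.
rewrite /continuation; case: ifPn st => // _ [_ Ob].
have [[tm nb _] [_ G4 _]] := mok.
have [h0 _ _] := interp_hat tm nb G4 (subset_closure Ob).
by apply: ler_sum => k _; rewrite ler_wpM2l.
Qed.

(** The lower barrier also bounds the values over all controls from below, so
   that their infimum in R has its intended meaning. *)
Lemma discrete_comparison (lo up : nat -> 'I_(nv m) -> R) uh :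
  discrete_solution P c Nt uh ->
  (forall n i a, (n < Nt)%N -> dom P (vtx m i) ->
     lo n i <= Sa P c Nt n i a (lo n.+1) /\ Sa P c Nt n i a (up n.+1) <= up n i) ->
  (forall n i, (n < Nt)%N -> bdry (dom P) (vtx m i) ->
     lo n i <= ubd P (tn P Nt n, vtx m i) <= up n i) ->
  (forall i, lo Nt i <= Psi P (vtx m i) <= up Nt i) ->
  forall n i, (n <= Nt)%N -> lo n i <= uh n i <= up n i.
Proof.
move=> [uT us] int lat ter n i nNt.
have [k] := ubnP (Nt - n); elim: k n nNt i => // k IH n nNt i.
move: nNt; rewrite leq_eqVlt => /orP[/eqP->|nNt nk]; first by rewrite uT.
have {}IH j : lo n.+1 j <= uh n.+1 j <= up n.+1 j.
  by apply: IH => //; rewrite subnS; move: nk; rewrite -subn_gt0 in nNt; case: (Nt - n)%N nNt.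
have [ub ui] := us n i nNt.
have [[_ _ G1] _] := mok.
have [Oi|bi] := vtx_domain i G1; last by rewrite ub// lat.
rewrite ui// /Sinf.
have lower a : lo n i <= Sa P c Nt n i a (uh n.+1).
  apply: le_trans (int n i a nNt Oi).1 _; apply: Sa_monotone => // j.
  by have /andP[] := IH j.
have [a _] := A0; apply/andP; split.
  apply: lb_le_inf; first by exists (Sa P c Nt n i a (uh n.+1)), a.
  by move=> _ [a' _ <-].
apply: le_trans (int n i a nNt Oi).2.
apply: (@le_trans _ _ (Sa P c Nt n i a (uh n.+1))).
  by apply: ge_inf; [exists (lo n i) => _ [a' _ <-]|exists a].
by apply: Sa_monotone => // j; have /andP[] := IH j.
Qed.

End Discrete.
End Comparison.

(** * The barrier estimate *)

Theorem proposition5p6 (R : realType) (N p : nat) (A : metricType R)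
    (P : hjb_data R N p A) (g : R) (G zeta : jet R N)
    (beta Ccomp : R) (c : cubature R p) (Cbd Cp Cpatch : R) (kappa Kbar : R) :
  (0 < N)%N -> (0 < p)%N ->
  [set: A] !=set0 -> compact [set: A] ->
  bounded_domain (dom P) -> 0 < horizon P ->
  bounded_domain_data P ->
  (forall z a, Qcl P z -> 0 <= rate P z a) ->
  Q1 P g G zeta -> Q2 P zeta beta -> Q3 P G zeta Ccomp ->
  cubature_ok c ->
  kappa = 1 ->
  Num.max Ccomp ((CG P G + 2 * kappa) / beta) <= Kbar ->
  let Phip := fun z => G z + Kbar * zeta z in
  let Phim := fun z => G z - Kbar * zeta z in
  exists Cbar : R, 0 < Cbar /\
  forall (m : mesh R N) (Nt : nat),
  (0 < Nt)%N -> dt P Nt <= 1 ->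
  mesh_ok P c m Nt Cbd Cp Cpatch ->
  let t := tn P Nt in
  let x := vtx m in
  let err := Cbar * (dt P Nt `^ (g / 2) + meshsize m ^+ 2 / dt P Nt) in
  (forall (n : nat) (i : 'I_(nv m)) (a : A), (n < Nt)%N -> dom P (x i) ->
     residual P c Nt n i a (Phip (t n, x i)) (fun k => Phip (t n.+1, x k))
       <= - kappa + err /\
     kappa - err <=
     residual P c Nt n i a (Phim (t n, x i)) (fun k => Phim (t n.+1, x k)))
  /\
  (err <= kappa / 2 ->
   (forall uh : nat -> 'I_(nv m) -> R, discrete_solution P c Nt uh ->
      forall n i, (n <= Nt)%N ->
        Phim (t n, x i) <= uh n i <= Phip (t n, x i)) /\
   (forall u : R * 'cV[R]_N -> R, strong_solution P u ->
      (exists B : R, forall z, Qcl P z -> `|u z| <= B) ->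
      forall z, Qcl P z -> Phim z <= u z <= Phip z)).
Proof.
move=> N0 _ A0 _ bd T0 data rate_ge0 q1 q2 q3 cub kE Kmax Phip Phim; subst kappa.
have [oO _ neO bO] := bd.
have [K K0 data_le] := data_bounds c N0 bd T0 data.
have [g01 cG cz lat [_ zT]] := q1.
have [C1 C10 tG] := C2g_tame T0 oO neO bO cG.
have [C2 C20 tz] := C2g_tame T0 oO neO bO cz.
have [beta0 Lz] := q2; have [Cc0 comp] := q3.
pose C := C1 + `|Kbar| * C2.
have C0 : 0 <= C by rewrite addr_ge0// mulr_ge0.
have Kc : Ccomp <= Kbar by move: Kmax; rewrite ge_max => /andP[].
have Kbeta : CG P G + 2 <= Kbar * beta.
  by move: Kmax; rewrite ge_max mulr1 ler_pdivrMr// => /andP[].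
have Kbar0 : 0 < Kbar by exact: lt_le_trans Kc.
pose wp := jet_lin Kbar G zeta; pose wm := jet_lin (- Kbar) G zeta.
have tp : tame (horizon P) (dom P) g C wp by exact: tame_lin.
have tm : tame (horizon P) (dom P) g C wm.
  by have := tame_lin (- Kbar) tG tz; rewrite normrN.
have wmE z : wm z = Phim z by rewrite /wm /Phim /= mulNr.
have FG z a : Qcl P z -> `|Fop P a G z| <= CG P G.
  move=> Qz; have [B FB] := Fop_bounded g C10 K0 cub data_le.
  apply: ub_le_sup; last by exists z, a.
  by exists B => _ [z' [a' [Qz' ->]]]; exact: (FB _ _ _ tG).
have inQ z : (`[0, horizon P] `*` dom P) z -> Qcl P z.
  by case: z => t x [/= ? ?]; split => //; exact: subset_closure.
have Fp z a : (`[0, horizon P] `*` dom P) z -> Fop P a wp z <= - 2.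
  move=> Oz; rewrite Fop_lin; have := FG z a (inQ z Oz); rewrite ler_norml => /andP[_ h].
  have : Kbar * Lop P a zeta z <= Kbar * (- beta) by rewrite ler_wpM2l ?(ltW Kbar0)// Lz.
  by rewrite mulrN; lra.
have Fm z a : (`[0, horizon P] `*` dom P) z -> 2 <= Fop P a wm z.
  move=> Oz; rewrite Fop_lin; have := FG z a (inQ z Oz); rewrite ler_norml => /andP[h _].
  have : Kbar * Lop P a zeta z <= Kbar * (- beta) by rewrite ler_wpM2l ?(ltW Kbar0)// Lz.
  by rewrite mulrN mulNr; lra.
have latT y : bdry (dom P) y -> lateral P (horizon P, y).
  by move=> by_; split; rewrite //= in_itv/= lexx ltW.
have match_lin k : matches_data P (jet_lin k G zeta).
  split=> [z /lat[Gz zz]|y by_] /=; first by rewrite Gz zz mulr0 addr0.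
  have [_ zz] := lat _ (latT y by_); have [cy _] := by_.
  have := comp y cy; rewrite zz mulr0 normr_le0 subr_eq0 => /eqP ->.
  by rewrite mulr0 addr0.
have terP x : closure (dom P) x -> Phim (horizon P, x) <= Psi P x <= Phip (horizon P, x).
  move=> cx; have := comp x cx; rewrite ler_norml => /andP[h1 h2].
  have : Ccomp * zeta (horizon P, x) <= Kbar * zeta (horizon P, x).
    by rewrite ler_wpM2r// zT.
  by rewrite /Phim /Phip => h3; apply/andP; split; lra.
have latP z : lateral P z -> Phim z = ubd P z /\ Phip z = ubd P z.
  by move=> /lat[Gz zz]; rewrite /Phim /Phip Gz zz mulr0 subr0 addr0.
have [E E0 cons] :=
  residual_consistency Cbd Cp Cpatch oO C0 g01 K0 cub rate_ge0 data_le.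
(* E may vanish, whereas the constant has to be positive *)
exists (E + 1); split; first by rewrite ltr_wpDl.
move=> m Nt Nt0 dt1 mok t x err.
have dt0 : 0 < dt P Nt by rewrite divr_gt0// ltr0n.
pose X := dt P Nt `^ (g / 2) + meshsize m ^+ 2 / dt P Nt.
have X0 : 0 <= X.
  by apply: addr_ge0; [exact: powR_ge0|rewrite divr_ge0 ?sqr_ge0// ltW].
have EX : E * X <= err by rewrite /err -/X ler_wpM2r// lerDl.
have res n i a : (n < Nt)%N -> dom P (x i) ->
    residual P c Nt n i a (Phip (t n, x i)) (fun k => Phip (t n.+1, x k)) <= - 1 + err /\
    1 - err <= residual P c Nt n i a (Phim (t n, x i)) (fun k => Phim (t n.+1, x k)).
  move=> nNt Oi; have [t0 tT] := tn_itv dt0 nNt.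
  have Oz : (`[0, horizon P] `*` dom P) (t n, x i).
    by split=> //=; rewrite in_itv/= t0 (le_trans _ tT)// lerDl ltW.
  have dt01 : 0 < dt P Nt <= 1 by rewrite dt0.
  have := cons m Nt n i a wp mok nNt dt01 t0 tT tp (match_lin _) Oi.
  have := cons m Nt n i a wm mok nNt dt01 t0 tT tm (match_lin _) Oi.
  have -> : (fun k => wm (tn P Nt n.+1, vtx m k)) = (fun k => Phim (t n.+1, x k)).
    by apply/funext => k; rewrite wmE.
  rewrite wmE -/X -/(t n) -/(x i) !ler_norml => /andP[m1 _] /andP[_ p2].
  have := Fp _ a Oz; have := Fm _ a Oz => h1 h2.
  by split; [move: p2; rewrite /wp /=; lra|lra].
split; first exact: res.
move=> errle.
have tNt : t Nt = horizon P.
  by rewrite /t /tn /dt mulrCA mulfV ?mulr1// pnatr_eq0 -lt0n.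
have [[_ _ G1] _] := mok.
split.
- move=> uh uhs; apply: (discrete_comparison oO cub dt0 A0 rate_ge0 mok uhs).
  + move=> n i a nNt Oi; have [rp rm] := res n i a nNt Oi.
    have tauV : 0 < (tau P c Nt n i a)^-1 by rewrite invr_gt0; exact: tau_gt0.
    split.
      rewrite -subr_ge0 -(pmulr_lge0 _ tauV).
      by apply: le_trans rm; lra.
    rewrite -subr_le0 -(pmulr_lle0 _ tauV).
    by apply: le_trans rp _; lra.
  + move=> n i nNt bi; have [t0 tT] := tn_itv dt0 nNt.
    have [|-> ->] := latP (t n, x i); last by rewrite lexx.
    by split=> //=; rewrite in_itv/= t0 (le_trans _ tT)// lerDl ltW.
  + move=> i; rewrite tNt; apply: terP.
    by have [Oi|[]//] := vtx_domain i G1; exact: subset_closure.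
- move=> u [cu sub sup] _ z Qz.
  have [B FB] := Fop_bounded g C0 K0 cub data_le.
  have bnd w : tame (horizon P) (dom P) g C w -> forall z a, Qcl P z ->
      `|Fop P a w z| <= B /\ `|rate P z a| <= K.
    by move=> tw z' a Qz'; split; [exact: FB tw Qz'|have [_ _ ? _] := data_le z' a Qz'].
  have cont w : tame (horizon P) (dom P) g C w -> {within Qcl P, continuous w}.
    by move=> [_ [cw _ _ _] _ _ _].
  have latI z' : (`[0, horizon P[ `*` bdry (dom P)) z' -> lateral P z'.
    case: z' => t' x' [/= t'T b']; split=> //=.
    by move: t'T; rewrite !in_itv/= => /andP[-> /ltW ->].
  have QTI z' : QT P z' -> (`[0, horizon P] `*` dom P) z'.
    case: z' => t' x' [/= t'T b']; split=> //=.
    by move: t'T; rewrite !in_itv/= => /andP[-> /ltW ->].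
  apply/andP; split.
    rewrite -wmE.
    have two_gt0 : 0 < 2 :> R by [].
    apply: (smooth_le_supersolution bO A0 rate_ge0 cu (cont _ tm) (tame_C12 tm)
      two_gt0 sup _ _ _ Qz).
    + by move=> z' a /QTI; exact: Fm.
    + by move=> z' /latI/latP[<- _]; rewrite wmE.
    + by move=> y cy; rewrite wmE; have /andP[] := terP y cy.
  apply: (subsolution_le_smooth bO A0 rate_ge0 (bnd _ tp) cu (cont _ tp) (tame_C12 tp)
    sub _ _ _ Qz).
  + by move=> z' a /QTI Oz'; apply: le_lt_trans (Fp z' a Oz') _; rewrite oppr_lt0.
  + by move=> z' /latI/latP[_ <-].
  + by move=> y cy; have /andP[] := terP y cy.
Qed.
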